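(* Let $G$ be a $\Delta$-critical graph. Then $$\overline{d}(G)\ \ge\ \min\left\{\frac{\Delta+\sqrt{2\Delta-1}}{2},\ \frac{\sqrt{17}-3}{2}(\Delta+1)\right\},$$ that is, $$\overline{d}(G)\ \ge\ \begin{cases}\dfrac{\sqrt{17}-3}{2}(\Delta+1) & \text{if } \Delta\le 112,\\[6pt] \dfrac{\Delta+\sqrt{2\Delta-1}}{2} & \text{if } \Delta\ge 113.\end{cases}$$ Moreover, if the multiplicity $\mu=\mu(G)$ satisfies $$\mu\ \le\ \max\left\{\frac{1+\sqrt{2\Delta-1}}{4},\ \frac12+\frac{\sqrt2}{4}\sqrt{(5-\sqrt{17})\Delta+3-\sqrt{17}}\right\},$$ then $$\overline{d}(G)\ \ge\ \min\left\{\frac{2\mu\Delta+2\mu(2\mu-1)}{4\mu-1},\ \frac{\sqrt{17}-3}{2}(\Delta+1)\right\}.$$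
   Context: All graphs are finite, undirected, loopless, and may contain parallel edges. The degree $d_G(x)$ of a vertex is the number of edges incident with it (parallel edges counted separately); $\Delta(G)$ is the maximum degree, $\overline{d}(G)=2|E(G)|/|V(G)|$ is the average degree, and the multiplicity $\mu(G)$ is the maximum number of edges joining a pair of distinct vertices. The chromatic index $\chi'(G)$ is the least $k$ such that $E(G)$ can be partitioned into $k$ matchings (equivalently, $G$ has a proper $k$-edge-coloring). $G$ is critical if $\chi'(H)<\chi'(G)$ for every proper subgraph $H$ of $G$. $G$ is $\Delta$-critical if $\Delta(G)=\Delta$, $\chi'(G)=\Delta+1$, and $G$ is critical. *)

(* Defs.v *)
From mathcomp Require Import all_boot all_order all_algebra.

Set Implicit Arguments.
Unset Strict Implicit.
Unset Printing Implicit Defensive.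

Import Order.TTheory GRing.Theory Num.Theory.

(* Edges form a type of their own, so distinct edges may have the same ends;
   [card_ends] excludes loops. *)
Record multigraph := Multigraph {
  vertex : finType;
  edge : finType;
  ends : edge -> {set vertex};
  card_ends : forall e, #|ends e| = 2 }.

Section Invariants.
Variable G : multigraph.

Definition degree (x : vertex G) : nat := #|[set e | x \in ends e]|.

Definition max_degree : nat := \max_(x : vertex G) degree x.

Definition multiplicity : nat :=
  \max_(p : vertex G * vertex G | p.1 != p.2)
    #|[set e | ends e == [set p.1; p.2]]|.

Definition average_degree (R : fieldType) : R :=
  (2 * #|edge G|%:R / #|vertex G|%:R)%R.

Definition matching (M : {set edge G}) : bool :=
  [forall e in M, forall f in M, (e != f) ==> [disjoint ends e & ends f]].

(* A partition of the edges into k (possibly empty) matchings, given by the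
   map sending each edge to the index of its part. *)
Definition edge_colorable (k : nat) : bool :=
  [exists c : {ffun edge G -> 'I_k},
    [forall i, matching [set e | c e == i]]].

Lemma edge_colorable_ex : exists k, edge_colorable k.
Proof.
exists #|edge G|; apply/existsP; exists [ffun e => enum_rank e].
apply/forallP=> i; apply/forall_inP=> e; rewrite inE ffunE => /eqP <-.
apply/forall_inP=> f; rewrite inE ffunE => /eqP /enum_rank_inj ->.
by rewrite eqxx.
Qed.

Definition chromatic_index : nat := ex_minn edge_colorable_ex.

Definition is_subgraph (W : {set vertex G}) (F : {set edge G}) : bool :=
  [forall e in F, ends e \subset W].

Section Subgraph.
Variables (W : {set vertex G}) (F : {set edge G}).
Hypothesis subWF : is_subgraph W F.

Definition sub_ends (e : {e | e \in F}) : {set {x | x \in W}} :=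
  [set x | val x \in ends (val e)].

Lemma card_sub_ends e : #|sub_ends e| = 2.
Proof.
rewrite -(card_ends (val e)) -(card_imset _ val_inj).
apply: eq_card => x; apply/imsetP/idP => [[y + ->]|xe]; first by rewrite inE.
have xW : x \in W by apply: subsetP xe; apply: (forall_inP subWF); apply: valP.
by exists (Sub x xW); rewrite ?inE.
Qed.

Definition subgraph : multigraph := Multigraph card_sub_ends.

End Subgraph.

End Invariants.

(* Proper subgraphs may lack just vertices: a critical graph has no isolated
   vertex, which the average degree depends on. *)
Definition critical (G : multigraph) : Prop :=
  forall (W : {set vertex G}) (F : {set edge G}) (sWF : is_subgraph W F),
    (W != setT) || (F != setT) ->
    chromatic_index (subgraph sWF) < chromatic_index G.

Definition delta_critical (G : multigraph) (Delta : nat) : Prop :=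
  [/\ max_degree G = Delta, chromatic_index G = Delta.+1 & critical G].

(* Main.v *)
Require Import Defs.
From mathcomp Require Import all_boot all_order all_algebra perm.
From mathcomp Require Import zify ring lra.

Set Implicit Arguments.
Unset Strict Implicit.
Unset Printing Implicit Defensive.

Import Order.TTheory GRing.Theory Num.Theory.

(** Write k for Delta and call a vertex small when its degree is below the
    target average q.  Every vertex y that is not small divides its surplus
    d(y) - q equally among its edges to small vertices ([gift]).  If each small
    vertex x receives at least its deficit q - d(x), the average degree is at
    least q ([discharge]).

    Two consequences of Vizing fans control the gifts.  For an edge xy, at
    least k + 1 - d(y) edges at x lead to vertices of degree at least
    2(k+1) - d(x) - d(y) ([near_fan_edges]).  When d(x) <= k + 1 - q, no
    neighbor of x is small, and the number of edges of y to small vertices plus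
    the deficiency k - d(y), called the load of y, is less than d(x)
    ([load_lt]); the gift of y along such an edge is then at least k - q
    divided by its load ([low_gift]).

    If d(x) >= k + 1 - q, bound the number of small edges of y by d(y) and let y
    be the neighbor of least degree.  The tightest case has d(x) = k + 1 - q and
    equal degrees on both sides of the fan bound; the total received suffices
    there exactly when q^2 + 3(k+1)q <= 2(k+1)^2, that is, when q is at most
    (sqrt 17 - 3)/2 times k + 1 ([medium_vertex]).

    If d = d(x) <= k + 1 - q, the loads give a total of at least
    d(k-q)/(d-1), which suffices when d(2q - k + 1 - d) <= q ([low_simple]).
    Maximizing the left side over d shows that every q from k/2 to
    (k + sqrt(2k-1))/2 qualifies.  This gives the bound without multiplicities.

    With multiplicity at most M, the condition only has to hold for d <= 2M and,
    by symmetry of the quadratic, for d >= 2q - k + 1 - 2M.  In between, x has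
    several neighbors and their loads cannot all be close to d.  The reason is a
    Kempe chain argument ([bad_pair]).  Leave an edge xy uncolored, and let w
    and v be the other ends of the edges at x colored i and j.  Suppose that at
    y each of the colors i and j is missing or leads to a small vertex other
    than x.  Then it
    cannot happen both that j is missing or leads to a small vertex at w, and
    that i does so at v.  Counting the pairs of colors for a neighbor y of
    largest load ([good_relation], [pair_share]) bounds the average load of the
    other neighbors and gives a total of at least (k-q) 2M/(2M-1).  That
    suffices for q at most (2Mk + 2M(2M-1))/(4M-1).

    The two bounds (k + sqrt(2k-1))/2 and (sqrt 17 - 3)(k+1)/2 cross between
    k = 112 and k = 113, so the bound with multiplicity only has to be proved for
    k >= 113; there the hypothesis on the multiplicity gives
    2M <= 2q - k + 1 - 2M. *)

(** * Alternating chains of two involutions *)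

Section Chains.
Variables (T : finType) (s1 s2 : T -> T).

Definition chain_rel : rel T := [rel u v | (s1 u == v) || (s2 u == v)].
Definition chain_end (v : T) : bool := (s1 v == v) || (s2 v == v).

Lemma iter_reflect m z : involutive s1 -> involutive s2 ->
  iter m (s1 \o s2) (s1 (iter m (s1 \o s2) z)) = s1 z.
Proof.
move=> i1 i2; elim: m z => // m IH z.
by rewrite [iter m.+1 _ z]iterS iterSr /= i1 i2 IH.
Qed.

Lemma alternate_inj : involutive s1 -> involutive s2 -> injective (s1 \o s2).
Proof. by move=> i1 i2; apply: inj_comp; apply: inv_inj. Qed.

(** The component of a path under s1 and s2, with end p fixed by s1, is one orbit
    of s1 \o s2: that map runs along every other vertex of the path, turns at the
    far end and comes back through the remaining ones. *)
Lemma chain_connect_orbit (p v : T) :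
  involutive s1 -> involutive s2 -> s1 p = p ->
  connect chain_rel p v -> fconnect (s1 \o s2) p v.
Proof.
move=> i1 i2 s1p /connectP[w].
have f_inj := alternate_inj i1 i2.
have stab1 z : fconnect (s1 \o s2) p z -> fconnect (s1 \o s2) p (s1 z).
  move=> pz; rewrite fconnect_sym //; move: (iter_findex pz).
  move: (findex _ _ _) => k e.
  have <- : iter k (s1 \o s2) (s1 z) = p by rewrite -e iter_reflect.
  exact: fconnect_iter.
have stab2 z : fconnect (s1 \o s2) p z -> fconnect (s1 \o s2) p (s2 z).
  move=> pz; rewrite -[s2 z]i1; apply: stab1.
  by apply: connect_trans pz _; apply: fconnect1.
elim/last_ind: w v => [v _ ->|w z IH v]; first exact: connect0.
rewrite rcons_path last_rcons => /andP[pw st] ->.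
have pl := IH _ pw erefl.
by case/orP: st => /eqP <-; [apply: stab1|apply: stab2].
Qed.

(** In an orbit of length n, the k-th iterate f^k p is fixed by s1 only when n
    divides 2k, and by s2 only when n divides 2k+1.  With k < n this leaves k = 0
    and one further vertex. *)
Lemma chain_two_ends_fixed (p q u : T) :
  involutive s1 -> involutive s2 -> s1 p = p ->
  chain_end q -> chain_end u ->
  connect chain_rel p q -> connect chain_rel p u ->
  [\/ p = q, p = u | q = u].
Proof.
move=> i1 i2 s1p eq eu /(chain_connect_orbit i1 i2 s1p) pq
  /(chain_connect_orbit i1 i2 s1p) pu.
set f := s1 \o s2 in pq pu.
have f_inj : injective f := alternate_inj i1 i2.
have refl_iter m z : iter m f (s1 (iter m f z)) = s1 z by apply: iter_reflect.
have small j : iter j f p = p -> j < 2 * order f p -> j = 0 \/ j = order f p.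
  have low l : iter l f p = p -> l < order f p -> l = 0.
    by move=> e lt; move: (findex_iter lt); rewrite e findex0.
  move=> e lt; case: (ltnP j (order f p)) => [|le]; first by left; apply: low.
  right; have := @low (j - order f p).
  rewrite -{1}(subnK le) iterD iter_order // in e.
  move=> /(_ e); lia.
have half v : fconnect f p v -> chain_end v ->
    v = p \/ findex f p v = (order f p)./2.
  move=> pv ev; move: (findex_max pv) (iter_findex pv).
  move: (findex f p v) => k kn ek.
  have : iter (k + k) f p = p \/ iter (k.+1 + k.+1).-1 f p = p.
    case/orP: ev => /eqP ev; [left|right].
      by rewrite iterD ek -{1}ev -{1}ek refl_iter.
    have -> : (k.+1 + k.+1).-1 = k.+1 + k by lia.
    rewrite iterD.
    have <- : s1 (iter k.+1 f p) = iter k f p by rewrite iterS ek /f /= i1.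
    by rewrite refl_iter.
  have -> : (k.+1 + k.+1).-1 = (k + k).+1 by lia.
  have k0 : k = 0 -> v = p by move=> k0; rewrite -ek k0.
  case=> e; (case: (small _ e) => [|h|h]; first by lia).
  - by left; apply: k0; lia.
  - by right; lia.
  - by lia.
  - by right; lia.
case: (half q pq eq) => [->|hq]; first by constructor 1.
case: (half u pu eu) => [->|hu]; first by constructor 2.
by constructor 3; rewrite -(iter_findex pq) -(iter_findex pu) hq hu.
Qed.

End Chains.

Lemma chain_relC (T : finType) (s1 s2 : T -> T) :
  chain_rel s1 s2 =2 chain_rel s2 s1.
Proof. by move=> u v; rewrite /chain_rel /= orbC. Qed.

Lemma chain_two_ends (T : finType) (s1 s2 : T -> T) (p q u : T) :
  involutive s1 -> involutive s2 ->
  chain_end s1 s2 p -> chain_end s1 s2 q -> chain_end s1 s2 u ->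
  connect (chain_rel s1 s2) p q -> connect (chain_rel s1 s2) p u ->
  [\/ p = q, p = u | q = u].
Proof.
move=> i1 i2 /orP[/eqP ep|/eqP ep] eq eu pq pu.
  exact: (chain_two_ends_fixed i1 i2).
apply: (chain_two_ends_fixed i2 i1 ep).
- by rewrite /chain_end orbC.
- by rewrite /chain_end orbC.
- by rewrite (eq_connect (chain_relC s2 s1)).
- by rewrite (eq_connect (chain_relC s2 s1)).
Qed.

(** * Partial edge colorings and Kempe swaps *)

Section OtherEnd.
Variable G : multigraph.
Implicit Types (f g : edge G) (u v : vertex G).

Definition other_end f v : vertex G := odflt v [pick u in ends f :\ v].

Lemma other_endP f v : v \in ends f ->
  ends f = [set v; other_end f v] /\ other_end f v != v.
Proof.
move=> vf; rewrite /other_end; case: pickP => [u|none] /=.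
  rewrite !inE => /andP[uv uf]; split=> //; apply/esym/eqP.
  by rewrite eqEcard card_ends cards2 eq_sym uv andbT subUset !sub1set vf uf.
have := cardsD1 v (ends f); rewrite vf card_ends.
by rewrite (eq_card0 none).
Qed.

Lemma other_end_in f v : v \in ends f -> other_end f v \in ends f.
Proof. by move=> /other_endP[-> _]; rewrite !inE eqxx orbT. Qed.

Lemma other_end_neq f v : v \in ends f -> other_end f v != v.
Proof. by case/other_endP. Qed.

Lemma other_endE f u v :
  u \in ends f -> v \in ends f -> u != v -> other_end f u = v.
Proof.
move=> /other_endP[-> _]; rewrite !inE => /orP[/eqP->|/eqP->//].
by rewrite eqxx.
Qed.

Lemma other_endK f v : v \in ends f -> other_end f (other_end f v) = v.
Proof.
by move=> vf; apply: other_endE; rewrite ?other_end_in ?other_end_neq.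
Qed.

Lemma mem_ends f u v : v \in ends f ->
  (u \in ends f) = (u == v) || (u == other_end f v).
Proof. by move=> /other_endP[-> _]; rewrite !inE. Qed.

End OtherEnd.

Section Colorings.
Variables (G : multigraph) (k : nat).
Implicit Types (f g e : edge G) (u v w z : vertex G) (K : {set vertex G}).
Implicit Types (i j a b : 'I_k).

(** Uncolored edges have value None. *)
Definition coloring := edge G -> option 'I_k.
Implicit Type c : coloring.

Definition proper_coloring c : Prop := forall v f g i,
  v \in ends f -> v \in ends g -> c f = Some i -> c g = Some i -> f = g.

(** The color class i as an involution of the vertices.  It fixes exactly the
    vertices at which i is missing, so that Kempe chains are the chains of two
    such involutions, and most of the argument never mentions edges. *)
Definition step c i v : vertex G :=
  if [pick f | (v \in ends f) && (c f == Some i)] is Some f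
  then other_end f v else v.

Lemma stepE c i v f : proper_coloring c -> v \in ends f -> c f = Some i ->
  step c i v = other_end f v.
Proof.
move=> pc vf cf; rewrite /step; case: pickP => [g /andP[vg /eqP cg]|].
  by rewrite (pc v g f i).
by move/(_ f); rewrite vf cf eqxx.
Qed.

Lemma stepP c i v :
  (exists2 f, v \in ends f & c f = Some i /\ step c i v = other_end f v) \/
  (forall f, v \in ends f -> c f <> Some i) /\ step c i v = v.
Proof.
rewrite /step; case: pickP => [f /andP[vf /eqP cf]|none]; [left|right].
  by exists f.
by split=> // f vf cf; have:= none f; rewrite vf cf eqxx.
Qed.

Lemma step_edge c i v : step c i v != v ->
  exists2 f, v \in ends f & c f = Some i /\ step c i v = other_end f v.
Proof. by case: (stepP c i v) => // -[_ ->]; rewrite eqxx. Qed.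

Lemma step_missP c i v :
  reflect (forall f, v \in ends f -> c f <> Some i) (step c i v == v).
Proof.
apply: (iffP eqP) => [|h]; case: (stepP c i v) => [[f vf [cf ->]]|[]] //.
  by move=> e; have := other_end_neq vf; rewrite e eqxx.
by case: (h f vf).
Qed.

Lemma stepK c i : proper_coloring c -> involutive (step c i).
Proof.
move=> pc v; case: (stepP c i v) => [[f vf [cf ->]]|[_ e]]; last by rewrite !e.
by rewrite (stepE pc (other_end_in vf) cf) other_endK.
Qed.

Definition recolor c f (o : option 'I_k) : coloring :=
  fun g => if g == f then o else c g.

Lemma proper_recolor c f i : proper_coloring c ->
  (forall v, v \in ends f -> step c i v = v) ->
  proper_coloring (recolor c f (Some i)).
Proof.
move=> pc mi v g h j vg vh; rewrite /recolor.
have no g' : v \in ends f -> v \in ends g' -> c g' <> Some i.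
  by move=> vf; apply/step_missP; rewrite mi.
case: (eqVneq g f) => [egf|gf]; case: (eqVneq h f) => [ehf|hf].
- by rewrite egf ehf.
- by move=> [<-] ch; case: (no h _ vh ch); rewrite -egf.
- by move=> cg [ei]; case: (no g _ vg); rewrite -?ehf ?ei.
- by apply: pc vg vh.
Qed.

Lemma proper_uncolor c f : proper_coloring c -> proper_coloring (recolor c f None).
Proof.
move=> pc v g h j vg vh; rewrite /recolor.
by case: (eqVneq g f) => // _; case: (eqVneq h f) => // _; apply: pc vg vh.
Qed.

Lemma step_recolor_out c f o i v : v \notin ends f ->
  step (recolor c f o) i v = step c i v.
Proof.
move=> vf; rewrite /step (@eq_pick _ _ (fun f0 => (v \in ends f0) && (c f0 == Some i))) //.
move=> g; rewrite /recolor; case: (eqVneq g f) => // ->.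
by rewrite (negPf vf).
Qed.

Lemma step_recolor_new c f i v : proper_coloring (recolor c f (Some i)) ->
  v \in ends f -> step (recolor c f (Some i)) i v = other_end f v.
Proof. by move=> pc vf; rewrite (stepE pc vf) // /recolor eqxx. Qed.

Lemma step_recolor_old c f o i v : proper_coloring c ->
  c f = Some i -> o != Some i -> v \in ends f ->
  step (recolor c f o) i v = v.
Proof.
move=> pc cf oi vf; apply/eqP/step_missP => g vg; rewrite /recolor.
case: (eqVneq g f) => [_|gf] cg; first by rewrite cg eqxx in oi.
by rewrite (pc v g f i) ?eqxx in gf.
Qed.

Lemma step_recolor_neq c f o i v :
  c f != Some i -> o != Some i ->
  step (recolor c f o) i v = step c i v.
Proof.
move=> cf oi; rewrite /step (@eq_pick _ _ (fun f0 => (v \in ends f0) && (c f0 == Some i))) //.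
move=> g; rewrite /recolor; case: (eqVneq g f) => // ->.
by rewrite (negPf cf) (negPf oi).
Qed.

(** Kempe swaps are performed on any set closed under both colors, rather than
    on a single chain; a 4-cycle then needs no separate treatment. *)
Definition step_closed c a b K : Prop :=
  forall v, v \in K -> step c a v \in K /\ step c b v \in K.

Definition swap c K a b : coloring :=
  fun f => if [disjoint ends f & K] then c f else omap (tperm a b) (c f).

Lemma swapE_in c K a b f v : v \in ends f -> v \in K ->
  swap c K a b f = omap (tperm a b) (c f).
Proof.
move=> vf vK; rewrite /swap; case: ifP => // /pred0P/(_ v) /=.
by rewrite vf vK.
Qed.

(** An edge with both a vertex inside and a vertex outside of a closed set has
    neither of the two colors. *)
Lemma swapE_out c K a b f v : proper_coloring c -> step_closed c a b K ->
  v \in ends f -> v \notin K -> swap c K a b f = c f.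
Proof.
move=> pc cl vf vK; rewrite /swap; case: ifP => // /negbT.
rewrite -setI_eq0 => /set0Pn[u]; rewrite inE => /andP[uf uK].
have uv : u != v by apply: contraNneq vK => <-.
case cf: (c f) => [i|] //=; congr Some.
have si : step c i u = v by rewrite (stepE pc uf cf) (other_endE uf vf).
apply: tpermD; apply/eqP=> e; case: (cl u uK); rewrite e si.
  by move=> h; rewrite h in vK.
by move=> _ h; rewrite h in vK.
Qed.

Lemma proper_swap c K a b : proper_coloring c -> step_closed c a b K ->
  proper_coloring (swap c K a b).
Proof.
move=> pc cl v f g i vf vg; case: (boolP (v \in K)) => vK.
  rewrite (swapE_in _ _ _ vf vK) (swapE_in _ _ _ vg vK).
  case cf: (c f) => [i1|] //= [e1]; case cg: (c g) => [i2|] //= [e2].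
  by apply: (pc v _ _ i1) => //; rewrite cg; congr Some; apply: (@perm_inj _ (tperm a b)); rewrite e1.
by rewrite !(swapE_out pc cl _ vK) //; apply: pc vf vg.
Qed.

Lemma step_swap_in c K a b i v : proper_coloring c -> step_closed c a b K ->
  v \in K -> step (swap c K a b) i v = step c (tperm a b i) v.
Proof.
move=> pc cl vK; have ps := proper_swap pc cl.
case: (stepP c (tperm a b i) v) => [[f vf [cf ->]]|[no ->]].
  by apply: stepE => //; rewrite (swapE_in _ _ _ vf vK) cf /= tpermK.
apply/eqP/step_missP => f vf; rewrite (swapE_in _ _ _ vf vK) => h.
apply: (no f vf); case: (c f) h => //= j [<-]; by rewrite tpermK.
Qed.

Lemma step_swap_out c K a b i v : proper_coloring c -> step_closed c a b K ->
  v \notin K -> step (swap c K a b) i v = step c i v.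
Proof.
move=> pc cl vK; have ps := proper_swap pc cl.
case: (stepP c i v) => [[f vf [cf ->]]|[no ->]].
  by apply: stepE => //; rewrite (swapE_out pc cl vf vK).
by apply/eqP/step_missP => f vf; rewrite (swapE_out pc cl vf vK); apply: no.
Qed.

Lemma step_swap_neq c K a b i v : proper_coloring c -> step_closed c a b K ->
  i != a -> i != b -> step (swap c K a b) i v = step c i v.
Proof.
move=> pc cl ia ib; case: (boolP (v \in K)) => vK.
  by rewrite step_swap_in // tpermD // eq_sym.
by rewrite step_swap_out.
Qed.

Lemma swap_None c K a b f : (swap c K a b f == None) = (c f == None).
Proof. by rewrite /swap; case: ifP => // _; case: (c f). Qed.

Definition chain c a b v : {set vertex G} :=
  [set u | connect (chain_rel (step c a) (step c b)) v u].

Lemma chain_refl c a b v : v \in chain c a b v.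
Proof. by rewrite inE connect0. Qed.

Lemma chain_closed c a b v : step_closed c a b (chain c a b v).
Proof.
move=> u; rewrite !inE => vu; split; apply: (connect_trans vu);
  by apply: connect1; rewrite /chain_rel /= eqxx ?orbT.
Qed.

Lemma chain_min c a b v K : step_closed c a b K -> v \in K ->
  chain c a b v \subset K.
Proof.
move=> cl vK; apply/subsetP=> u; rewrite inE => /connectP[s].
elim: s v vK => [|w s IH] v vK /=; first by move=> _ ->.
case/andP=> st ps e; apply: (IH w) => //.
by have [? ?] := cl v vK; case/orP: st => /eqP <-.
Qed.

(** A component of two color classes is a path or a cycle, so it has at most two
    vertices that miss one of the two colors. *)
Lemma chain_ends c a b p q u : proper_coloring c ->
  (step c a p = p \/ step c b p = p) ->
  (step c a q = q \/ step c b q = q) ->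
  (step c a u = u \/ step c b u = u) ->
  q \in chain c a b p -> u \in chain c a b p ->
  [\/ p = q, p = u | q = u].
Proof.
have E v : step c a v = v \/ step c b v = v -> chain_end (step c a) (step c b) v.
  by rewrite /chain_end => -[] ->; rewrite eqxx ?orbT.
move=> pc /E ep /E eq /E eu; rewrite !inE => pq pu.
by apply: chain_two_ends ep eq eu pq pu; apply: stepK.
Qed.

Lemma chain_sym c a b u v : proper_coloring c ->
  (u \in chain c a b v) = (v \in chain c a b u).
Proof.
move=> pc; rewrite !inE; apply: sym_connect_sym => {u v} u v.
rewrite /chain_rel /= (inv_eq (stepK a pc)) (inv_eq (stepK b pc)).
by rewrite eq_sym [u == _]eq_sym.
Qed.

Lemma chain_trans c a b u v w :
  v \in chain c a b u -> w \in chain c a b v -> w \in chain c a b u.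
Proof. by rewrite !inE; apply: connect_trans. Qed.

Lemma eq_chain c c' a b v :
  step c a =1 step c' a -> step c b =1 step c' b ->
  chain c a b v = chain c' a b v.
Proof.
move=> ea eb; apply/setP => u; rewrite !inE; apply: eq_connect => x y.
by rewrite /chain_rel /= ea eb.
Qed.

Lemma step_closedC c a b K : step_closed c a b K -> step_closed c b a K.
Proof. by move=> cl v /cl[]. Qed.

Lemma step_inj c i : proper_coloring c -> injective (step c i).
Proof. by move=> pc; apply/inv_inj/stepK. Qed.

Definition missing c v : {set 'I_k} := [set i | step c i v == v].

Lemma missingP c v i : reflect (step c i v = v) (i \in missing c v).
Proof. by rewrite inE; apply: eqP. Qed.

Lemma card_step_edges c v (P : pred (vertex G)) : proper_coloring c ->
  #|[set i | (step c i v != v) && P (step c i v)]| =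
  #|[set f | [&& v \in ends f, c f != None & P (other_end f v)]]|.
Proof.
move=> pc; pose S := [set f | [&& v \in ends f, c f != None & P (other_end f v)]].
rewrite -/S -[RHS](card_in_imset (f := c)); last first.
  move=> f g; rewrite !inE => /and3P[vf cf _] /and3P[vg _ _].
  by case E: (c f) cf => [i|] // _ /esym cg; apply: pc vf vg E cg.
rewrite -(card_imset _ (@Some_inj _)); apply: eq_card => o.
apply/imsetP/imsetP => [[i]|[f]]; rewrite !inE.
  case/andP=> /step_edge[f vf [cf si]] Pf ->; exists f => //.
  by rewrite inE vf cf -si.
case/and3P=> vf; case cf: (c f) => [i|] // _ Pf ->; exists i => //.
by rewrite inE (stepE pc vf cf) other_end_neq.
Qed.

Lemma card_missing c v : proper_coloring c ->
  #|missing c v| + #|[set f | (v \in ends f) && (c f != None)]| = k.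
Proof.
move=> pc; have := card_step_edges v predT pc.
have -> : [set f | [&& v \in ends f, c f != None & predT (other_end f v)]] =
          [set f | (v \in ends f) && (c f != None)].
  by apply/setP => f; rewrite !inE andbT.
move=> <-.
have -> : [set i | (step c i v != v) && predT (step c i v)] = ~: missing c v.
  by apply/setP => i; rewrite !inE andbT.
by rewrite cardsC card_ord.
Qed.

Lemma card_missing_degree c v : proper_coloring c -> k <= #|missing c v| + degree v.
Proof.
move=> pc; rewrite -{1}(card_missing v pc) leq_add2l; apply: subset_leq_card.
by apply/subsetP => f; rewrite !inE => /andP[].
Qed.

End Colorings.

Arguments chain_closed {G k} c a b v.

(** * Colorings with one uncolored edge *)

Section Kempe.
Variables (G : multigraph) (k : nat).
Hypothesis max_deg : forall v : vertex G, degree v <= k.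
Hypothesis no_coloring :
  forall c : coloring G k, proper_coloring c -> exists f, c f = None.
Implicit Types (f g e : edge G) (u v w x y z : vertex G) (K : {set vertex G}).
Implicit Types (i j a b : 'I_k) (c : coloring G k).

(** The colorings of G minus one edge that a critical graph provides. *)
Record near_coloring c e x y : Prop := Near {
  near_proper : proper_coloring c;
  near_left : x \in ends e;
  near_right : other_end e x = y;
  near_none : c e = None;
  near_some : forall f, f != e -> c f != None }.

Lemma near_neq c e x y : near_coloring c e x y -> x != y.
Proof. by case=> _ xe <- _ _; rewrite eq_sym other_end_neq. Qed.

Lemma near_ends c e x y v : near_coloring c e x y -> (v \in ends e) = (v == x) || (v == y).
Proof. by case=> _ xe <- _ _; apply: mem_ends. Qed.

Lemma near_no_common c e x y i :
  near_coloring c e x y -> step c i x = x -> step c i y = y -> False.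
Proof.
move=> nc mx my; have [pc _ _ _ some] := nc.
have [|f] := no_coloring (c := recolor c e (Some i)).
  apply: proper_recolor => // v; rewrite (near_ends v nc).
  by case/orP => /eqP->.
by rewrite /recolor; case: (eqVneq f e) => // /some /eqP.
Qed.

Lemma near_swap c e x y K a b :
  near_coloring c e x y -> step_closed c a b K -> near_coloring (swap c K a b) e x y.
Proof.
move=> [pc xe xy none some] cl; split=> //; first exact: proper_swap.
  by apply/eqP; rewrite swap_None none.
by move=> f fe; rewrite swap_None some.
Qed.

(** Otherwise a swap on the chain of x frees the color j at x as well as at y,
    and the uncolored edge could receive it. *)
Lemma near_linked c e x y i j :
  near_coloring c e x y -> step c i x = x -> step c j y = y -> y \in chain c i j x.
Proof.
move=> nc mx my; apply/negP => ny.
have pc := near_proper nc; have cl := chain_closed c i j x.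
apply: (near_no_common (near_swap nc cl) (i := j)).
  by rewrite step_swap_in ?chain_refl // tpermR.
by rewrite step_swap_out //; apply/negP.
Qed.

Lemma card_missing_near c e x y v : near_coloring c e x y -> v \in ends e ->
  #|missing c v| + degree v = k.+1.
Proof.
move=> [pc _ _ none some] ve; have E := card_missing v pc.
apply: etrans (congr1 S E); rewrite -addnS.
congr (_ + _); rewrite /degree [LHS](cardsD1 e) inE ve add1n.
congr _.+1; apply: eq_card => f; rewrite !inE andbC; apply: andb_id2l => vf.
by case: (eqVneq f e) => [->|/some -> //]; rewrite none eqxx.
Qed.

Lemma near_missing c e x y v : near_coloring c e x y -> v \in ends e ->
  exists i, step c i v = v.
Proof.
move=> nc ve; have := card_missing_near nc ve; have := max_deg v => dv sum.
have /card_gt0P[i /missingP] : 0 < #|missing c v| by lia.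
by exists i.
Qed.

(** The edge from y to z moves from color i to color j. *)
Lemma near_toggle c e x y z i j : near_coloring c e x y ->
  step c j y = y -> step c j z = z -> step c i y = z -> z != y ->
  exists2 c', near_coloring c' e x y & [/\ step c' j y = z, step c' j z = y,
    step c' i y = y /\ step c' i z = z,
    forall l v, v != y -> v != z -> step c' l v = step c l v &
    forall l v, l != i -> l != j -> step c' l v = step c l v].
Proof.
move=> nc jy jz iy zy; have [pc xe exy none some] := nc.
have [f yf [cf fz]] : exists2 f, y \in ends f & c f = Some i /\ step c i y = other_end f y.
  by apply: step_edge; rewrite iy.
rewrite iy in fz.
have zf : z \in ends f by rewrite fz other_end_in.
have endsf v : (v \in ends f) = (v == y) || (v == z) by rewrite fz; apply: mem_ends.
have pc' : proper_coloring (recolor c f (Some j)).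
  by apply: proper_recolor => // v; rewrite endsf => /orP[]/eqP->.
have ij : j != i by apply: contraNneq zy => ji; rewrite -jy ji iy.
have ji' : Some j != Some i by [].
exists (recolor c f (Some j)); split=> //.
- by rewrite /recolor; case: (eqVneq e f) => // ef; rewrite -ef none in cf.
- by move=> g ge; rewrite /recolor; case: (eqVneq g f) => // _; apply: some.
- by rewrite step_recolor_new.
- by rewrite step_recolor_new // fz other_endK.
- by rewrite !(step_recolor_old pc cf).
- by move=> l v vy vz; rewrite step_recolor_out // endsf negb_or vy.
- move=> l v li lj; rewrite step_recolor_neq //.
    by rewrite cf; apply: contra_neq li => -[].
  by apply: contra_neq lj => -[].
Qed.

(** The uncolored edge rotates around x: xy takes the color i missing at y, and
    the i-edge of x loses its color.  Afterwards w plays the part of y. *)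
Lemma near_shift c e x y w i : near_coloring c e x y ->
  step c i y = y -> step c i x = w -> w != x ->
  exists c' e', [/\ near_coloring c' e' x w, step c' i w = w, step c' i x = y &
    forall l v, l != i -> step c' l v = step c l v].
Proof.
move=> nc iy ix wx; have [pc xe exy none some] := nc.
have [f xf [cf fw]] : exists2 f, x \in ends f & c f = Some i /\ step c i x = other_end f x.
  by apply: step_edge; rewrite ix.
rewrite ix in fw.
have wf : w \in ends f by rewrite fw other_end_in.
have ye : y \in ends e by rewrite -exy other_end_in.
have ef : e != f by apply: contra_eq_neq cf => <-; rewrite none.
have pu : proper_coloring (recolor c f None) by apply: proper_uncolor.
have wy : w != y.
  apply: contra_neq wx => wy.
  by rewrite -[RHS](stepK i pc) ix wy iy.
have wne : w \notin ends e by rewrite (near_ends _ nc) negb_or wx.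
have pn : proper_coloring (recolor (recolor c f None) e (Some i)).
  apply: proper_recolor => // v; rewrite (near_ends _ nc) => /orP[]/eqP->.
    by rewrite (step_recolor_old pc cf).
  rewrite step_recolor_out // (mem_ends _ wf) negb_or eq_sym wy /= fw other_endK //.
  by rewrite eq_sym (near_neq nc).
exists (recolor (recolor c f None) e (Some i)), f; split; [split=> //|..].
- by rewrite /recolor eq_sym (negPf ef) eqxx.
- move=> g gf; rewrite /recolor; case: (eqVneq g e) => // ge; rewrite (negPf gf).
  exact: some.
- by rewrite step_recolor_out // (step_recolor_old pc cf).
- by rewrite step_recolor_new.
- move=> l v li; rewrite step_recolor_neq ?step_recolor_neq //.
  + by rewrite cf; apply: contra_neq li => -[].
  + by rewrite /recolor (negPf ef) none.
  + by apply: contra_neq li => -[].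
Qed.

(** Vizing fan: if z and y both miss j, recoloring yz with j frees i at y. *)
Lemma near_fan_right c e x y i j z : near_coloring c e x y ->
  step c i x = x -> step c i y = z -> step c j y = y -> step c j z = z -> False.
Proof.
move=> nc ix iy jy jz; case: (eqVneq z y) => [zy|zy].
  by apply: (near_no_common nc ix); rewrite iy.
have [c' nc' [_ _ [iy' _] out _]] := near_toggle nc jy jz iy zy.
have xz : x != z.
  by apply/negP => /eqP xz; apply: (near_no_common nc _ jy); rewrite xz.
by apply: (near_no_common nc' _ iy'); rewrite out // (near_neq nc).
Qed.

(** If z and x both miss j, take a color l missing at y.  The (j,l)-chain of x
    ends at y, so swapping the chain of z leaves x and y alone and makes z miss l,
    which [near_fan_right] excludes. *)
Lemma near_fan_left c e x y i j z : near_coloring c e x y ->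
  step c i x = x -> step c i y = z -> step c j x = x -> step c j z = z -> False.
Proof.
move=> nc ix iy jx jz; have pc := near_proper nc.
have ye : y \in ends e by rewrite (near_ends _ nc) eqxx orbT.
have [l ly] := near_missing nc ye.
have zy : z != y.
  by apply/negP => /eqP zy; apply: (near_no_common nc ix); rewrite iy.
have xz : x != z.
  apply: contra_neq zy => xz.
  by rewrite -[RHS](stepK i pc) iy -xz ix.
have cl := chain_closed c j l z.
have yC := near_linked nc jx ly.
have zC : z \notin chain c j l x.
  apply/negP => zC.
  have [] := chain_ends pc (or_introl jx) (or_intror ly) (or_introl jz) yC zC.
  - by apply/eqP; exact: near_neq nc.
  - exact/eqP.
  - by apply/eqP; rewrite eq_sym.
have xK : x \notin chain c j l z by rewrite chain_sym.
have yK : y \notin chain c j l z.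
  by apply: contra zC => yK; rewrite chain_sym in yK => //; apply: chain_trans yC yK.
have il : i != l by apply: contraNneq zy => il; rewrite -iy il ly.
have ij : i != j.
  by apply: contraNneq zy => ij; rewrite -[y in _ == y](stepK i pc) iy ij jz.
apply: (@near_fan_right (swap c (chain c j l z) j l) e x y i l z) => //.
- exact: near_swap.
- by rewrite step_swap_out.
- by rewrite step_swap_out.
- by rewrite step_swap_out.
- by rewrite step_swap_in ?chain_refl // tpermR.
Qed.


(** * Small vertices around the uncolored edge *)

(** Below, Sm stands for the small vertices other than x. *)
Section SmallVertices.
Variables (x : vertex G) (Sm : pred (vertex G)).
Hypothesis small_x : ~~ Sm x.
Hypothesis small_nbr : forall f, x \in ends f -> ~~ Sm (other_end f x).
Hypothesis small_deg : forall u, Sm u -> degree u + degree x <= k.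

(** The colors that count toward the load of v. *)
Definition bad c i v : bool := (step c i v == v) || Sm (step c i v).

Lemma small_neq u : Sm u -> x != u.
Proof. by move=> su; apply: contraNneq small_x => ->. Qed.

Lemma small_step c i : step c i x != x -> ~~ Sm (step c i x).
Proof. by case/step_edge => f xf [_ ->]; apply: small_nbr. Qed.

Lemma small_right c e y : near_coloring c e x y -> ~~ Sm y.
Proof. by case=> _ xe <- _ _; apply: small_nbr. Qed.

Lemma card_small_common c e y u : near_coloring c e x y -> Sm u ->
  k.+1 <= #|missing c u :&: missing c x| + degree u + degree x.
Proof.
move=> nc su; have pc := near_proper nc.
have mu := card_missing_degree u pc.
have mx := card_missing_near nc (near_left nc).
have := cardsUI (missing c u) (missing c x).
have := max_card (missing c u :|: missing c x).
rewrite card_ord => le; lia.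
Qed.

(** A small vertex misses so many colors, and so does x, that they share one. *)
Lemma small_common c e y u : near_coloring c e x y -> Sm u ->
  exists2 a, step c a u = u & step c a x = x.
Proof.
move=> nc su; have := card_small_common nc su; have := small_deg su => h1 h2.
have /card_gt0P[a] : 0 < #|missing c u :&: missing c x| by lia.
by rewrite inE => /andP[/missingP au /missingP ax]; exists a.
Qed.

Lemma near_fan_small c e y i : near_coloring c e x y -> step c i x = x ->
  ~~ Sm (step c i y).
Proof.
move=> nc ix; apply/negP => /(small_common nc)[a au ax].
exact: near_fan_left nc ix erefl ax au.
Qed.

(** Were u outside of the chain of x, swapping the chain of u would make its edge
    to y carry the color a missing at x, against [near_fan_small]. *)
Lemma linked_small_right c e y j a : near_coloring c e x y -> Sm (step c j y) ->
  step c a (step c j y) = step c j y -> step c a x = x ->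
  step c j y \in chain c a j x.
Proof.
move=> nc su au ax; apply/negP => nu; have pc := near_proper nc.
set u := step c j y in su au nu.
have cl := chain_closed c a j u.
have xK : x \notin chain c a j u by rewrite chain_sym //; apply/negP.
have yK : y \in chain c a j u.
  by have [_] := cl u (chain_refl _ _ _ _); rewrite /u stepK.
have nc' := near_swap nc cl.
have := near_fan_small nc' (i := a).
by rewrite step_swap_out // step_swap_in // tpermL -/u su => /(_ ax).
Qed.

(** This is [linked_small_right] after the uncolored edge rotates to xw. *)
Lemma linked_small_left c e y w i j a : near_coloring c e x y ->
  step c i y = y -> step c i x = w -> w != x -> Sm (step c j w) ->
  step c a (step c j w) = step c j w -> step c a x = x ->
  step c j w \in chain c a j x.
Proof.
move=> nc iy ix wx su au ax; have pc := near_proper nc.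
have ji : j != i.
  by apply: contraTneq su => ->; rewrite -ix stepK.
have ai : a != i by apply: contraNneq wx => ai; rewrite -ix -ai ax.
have [c' [e' [nc' _ _ eq]]] := near_shift nc iy ix wx.
rewrite (eq_chain (c' := c')) => [|v|v]; rewrite -?eq //.
by apply: linked_small_right nc' _ _ _; rewrite !eq.
Qed.

(** Both small vertices would be ends of the (a,j)-chain that starts at x. *)
Lemma no_common_color c e y w i j a : near_coloring c e x y ->
  step c i y = y -> step c i x = w -> w != x ->
  Sm (step c j y) -> Sm (step c j w) ->
  step c a (step c j y) = step c j y -> step c a (step c j w) = step c j w ->
  step c a x = x -> False.
Proof.
move=> nc iy ix wx su0 su au0 au ax; have pc := near_proper nc.
have h0 := linked_small_right nc su0 au0 ax.
have h := linked_small_left nc iy ix wx su au ax.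
have [] := chain_ends pc (or_introl ax) (or_introl au0) (or_introl au) h0 h.
- by apply/eqP/small_neq.
- by apply/eqP/small_neq.
move/(step_inj pc) => yw; move/negP: (near_neq nc); apply; apply/eqP.
by rewrite -(stepK i pc x) ix -yw iy.
Qed.

(** The (a,j)-chain from x ends at y, hence not at the small vertex, for every
    color a missing at x and at the small vertex. *)
Lemma two_missing_small c e y w i j : near_coloring c e x y ->
  step c i y = y -> step c j y = y -> step c i x = w -> w != x ->
  ~~ Sm (step c j w).
Proof.
move=> nc iy jy ix wx; apply/negP => su; have pc := near_proper nc.
have [a au ax] := small_common nc su.
have h := linked_small_left nc iy ix wx su au ax.
have h0 := near_linked nc ax jy.
have [] := chain_ends pc (or_introl ax) (or_intror jy) (or_introl au) h0 h.
- by apply/eqP; exact: near_neq nc.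
- by apply/eqP/small_neq.
- by move=> yu; move: (small_right nc); rewrite yu su.
Qed.

(** For a color a missing at x, the (a,j)-chain from x ends at y, and after
    rotation it ends at w. *)
Lemma two_missing_both c e y w i j : near_coloring c e x y ->
  step c i y = y -> step c j y = y -> step c i x = w -> w != x ->
  i != j -> step c j w != w.
Proof.
move=> nc iy jy ix wx ij; apply/negP => /eqP jw; have pc := near_proper nc.
have [a ax] := near_missing nc (near_left nc).
have ai : a != i by apply: contraNneq wx => ai; rewrite -ix -ai ax.
have [c' [e' [nc' _ _ eq]]] := near_shift nc iy ix wx.
have h0 := near_linked nc ax jy.
have h : w \in chain c a j x.
  rewrite (eq_chain (c' := c')) => [|v|v]; rewrite ?eq // 1?eq_sym //.
  by apply: near_linked nc' _ _; rewrite eq // eq_sym.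
have [] := chain_ends pc (or_introl ax) (or_intror jy) (or_intror jw) h0 h.
- by apply/eqP; exact: near_neq nc.
- by apply/eqP; rewrite eq_sym.
- move=> yw; move/negP: (near_neq nc); apply; apply/eqP.
  by rewrite -(stepK i pc x) ix -yw iy.
Qed.

(** Rotation to xw exchanges the parts of y and w in [two_missing_small]. *)
Lemma two_missing_left c e y w i j : near_coloring c e x y ->
  step c i y = y -> step c i x = w -> w != x -> i != j ->
  Sm (step c j y) -> step c j w != w.
Proof.
move=> nc iy ix wx ij su; apply/negP => /eqP jw; have pc := near_proper nc.
have [c' [e' [nc' iw' ix' eq]]] := near_shift nc iy ix wx.
have yx : y != x by rewrite eq_sym (near_neq nc).
have jE l : step c' j l = step c j l by rewrite eq // eq_sym.
have := two_missing_small nc' iw' (etrans (jE w) jw) ix' yx.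
by rewrite jE su.
Qed.

Hypothesis small_deg3 :
  forall u, Sm u -> 3 * degree u + 2 * degree x < 2 * k.+1.

(** Three pairwise disjoint sets of this size do not fit into the colors missing
    at x. *)
Lemma three_small_share c e y p q r : near_coloring c e x y -> Sm p -> Sm q -> Sm r ->
  exists2 a, step c a x = x &
    [\/ step c a p = p /\ step c a q = q,
       step c a p = p /\ step c a r = r |
       step c a q = q /\ step c a r = r].
Proof.
move=> nc sp sq sr; pose X u := missing c u :&: missing c x.
have share u v : X u :&: X v != set0 ->
    exists a, [/\ step c a x = x, step c a u = u & step c a v = v].
  case/set0Pn => a; rewrite !inE.
  by case/andP=> /andP[/eqP ? /eqP ?] /andP[/eqP ? _]; exists a.
case: (eqVneq (X p :&: X q) set0) => [pq|/share[a [? ? ?]]]; last first.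
  by exists a => //; constructor 1.
case: (eqVneq (X p :&: X r) set0) => [pr|/share[a [? ? ?]]]; last first.
  by exists a => //; constructor 2.
case: (eqVneq (X q :&: X r) set0) => [qr|/share[a [? ? ?]]]; last first.
  by exists a => //; constructor 3.
have sub : X p :|: X q :|: X r \subset missing c x by rewrite !subUset !subsetIr.
have := subset_leq_card sub; have := cardsUI (X p :|: X q) (X r).
rewrite setIUl pr qr setU0 cards0; have := cardsUI (X p) (X q); rewrite pq cards0.
have := card_missing_near nc (near_left nc).
have := card_small_common nc sp; have := card_small_common nc sq.
have := card_small_common nc sr; rewrite -/(X _) -/(X _) -/(X _).
have := small_deg3 sp; have := small_deg3 sq; have := small_deg3 sr.
lia.
Qed.

(** Write u0, u and u' for the small vertices reached from y by j, from w by j and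
    from v by i.  Since u0 misses i, recoloring the edge from y to u0 from j to i
    exchanges the parts of (i, w, u) and (j, v, u').  By [no_common_color], u0
    shares no color missing at x with u or with u', so by [three_small_share] u
    and u' share such a color b.

    If u and u' differ, the recoloring cuts the edge from y to u0 out of the
    (b,j)-chain from x to u, leaving a chain from x to y and one from u0 to u;
    swapping the latter gives b to u0 without taking it from u'.

    If u = u', then x, w, u, v form a cycle colored i and j alternately.  The
    (b,j)-chain from x must end at y both before and after this cycle is
    swapped.  Before, it leaves x through v and avoids w and u; exchanging x for u
    in it then gives a closed set that contains y but not x. *)
Lemma bad_pair_core c e y w v i j : near_coloring c e x y ->
  step c i y = y -> Sm (step c j y) ->
  step c i (step c j y) = step c j y ->
  step c i x = w -> w != x -> step c j x = v -> v != x ->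
  Sm (step c j w) -> Sm (step c i v) -> False.
Proof.
move=> nc iy; move u0E : (step c j y) => u0 su0 iu0 ix wx jx vx.
move uE : (step c j w) => u su; move u'E : (step c i v) => u' su'.
have pc := near_proper nc; have xy := near_neq nc.
have x_u0 := small_neq su0; have xu := small_neq su; have xu' := small_neq su'.
have swN : ~~ Sm w by rewrite -ix; apply: small_step; rewrite ix.
have svN : ~~ Sm v by rewrite -jx; apply: small_step; rewrite jx.
have syN := small_right nc.
have SmN p q : Sm p -> ~~ Sm q -> q != p.
  by move=> sp; apply: contraNneq => ->.
have ij : i != j.
  by apply: contraNneq (SmN _ _ su0 syN) => ij; rewrite -u0E -ij iy.
have wy : w != y by apply: contra_neq xy => wy; rewrite -(stepK i pc x) ix wy iy.
have vy : v != y.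
  by apply: contraNneq small_x => vy; rewrite -(stepK j pc x) jx vy u0E.
have ju0 : step c j u0 = y by rewrite -u0E stepK.
have ju : step c j u = w by rewrite -uE stepK.
have iu' : step c i u' = v by rewrite -u'E stepK.
have u_u0 : u != u0 by apply: contra_neq wy => uu0; rewrite -ju uu0.
have u'_u0 : u' != u0.
  by apply: contraNneq svN => uu0; rewrite -iu' uu0 iu0.
have u0y : u0 != y by rewrite eq_sym; apply: SmN.
have uy : u != y by rewrite eq_sym; apply: SmN.
have u'y : u' != y by rewrite eq_sym; apply: SmN.
have wu0 := SmN _ _ su0 swN; have vu0 := SmN _ _ su0 svN.
have [c2 nc2 [iy2 iu02 [jy2 ju02] out2 eq2]] :=
  near_toggle nc iy iu0 u0E u0y.
have pc2 := near_proper nc2.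
have xK2 l : step c2 l x = step c l x by rewrite out2 // eq_sym.
have missx a : step c a x = x -> (a != i) * (a != j).
  move=> ax; split; apply: contraNneq vx => al.
    by rewrite -ix -al ax eqxx in wx.
  by rewrite -jx -al ax.
(* [c2] is [c] with the edge from y to u0 recolored; [no_common_color] applies
   in both. *)
have AB a : step c a x = x -> step c a u0 = u0 -> step c a u != u.
  move=> ax au0; apply/negP => /eqP au.
  by apply: (@no_common_color c e y w i j a) => //; rewrite ?u0E ?uE.
have AB' a : step c a x = x -> step c a u0 = u0 -> step c a u' != u'.
  move=> ax au0; apply/negP => /eqP au'; have [ai aj] := missx a ax.
  apply: (@no_common_color c2 e y v j i a) => //;
    by rewrite ?iy2 ?xK2 ?(out2 i v) ?u'E ?eq2.
have [b bx [bu bu']] : exists2 b, step c b x = x & step c b u = u /\ step c b u' = u'.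
  have [b bx [[bu0 bu]|[bu0 bu']|[bu bu']]] := three_small_share nc su0 su su'.
  - by move: (AB b bx bu0); rewrite bu eqxx.
  - by move: (AB' b bx bu0); rewrite bu' eqxx.
  - by exists b.
have [bi bj] := missx b bx.
have bx2 : step c2 b x = x by rewrite xK2.
have bE l : step c2 b l = step c b l by rewrite eq2.
have yC2 : y \in chain c2 b j x := near_linked nc2 bx2 jy2.
have bu2 : step c2 b u = u by rewrite bE.
have uC2 : u \notin chain c2 b j x.
  apply/negP => uC2.
  have [] := chain_ends pc2 (or_introl bx2) (or_intror jy2) (or_introl bu2) yC2 uC2.
  - exact/eqP.
  - exact/eqP.
  - by apply/eqP; rewrite eq_sym.
have u0C2 : u0 \notin chain c2 b j x.
  apply/negP => u0C2.
  have [] := chain_ends pc2 (or_introl bx2) (or_intror jy2) (or_intror ju02) yC2 u0C2.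
  - exact/eqP.
  - exact/eqP.
  - by apply/eqP; rewrite eq_sym.
have uC : u \in chain c b j x.
  by rewrite -uE; apply: linked_small_left nc iy ix wx _ _ bx; rewrite uE.
have SK : x \in chain c2 b j y by rewrite chain_sym.
have bu2' : step c2 b u' = u' by rewrite bE.
case: (eqVneq u u') => [uu'|uu'].
  pose K := [set x; w; u; v].
  have outK l z : z \in K -> step c2 l z = step c l z.
    by rewrite !inE -!orbA => /or4P[]/eqP->; rewrite out2 // eq_sym.
  have iw : step c i w = x by rewrite -ix stepK.
  have jv : step c j v = x by rewrite -jx stepK.
  have iu : step c i u = v by rewrite uu'.
  have iv : step c i v = u by rewrite uu'.
  have clK : step_closed c2 i j K.
    move=> z zK; rewrite !outK //; move: zK; rewrite !inE -!orbA.
    by case/or4P=> /eqP->; rewrite ?ix ?jx ?iw ?uE ?iu ?ju ?iv ?jv !eqxx ?orbT.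
  have xK : x \in K by rewrite !inE eqxx.
  have uK : u \in K by rewrite !inE eqxx ?orbT.
  have vK : v \in K by rewrite !inE eqxx ?orbT.
  have yK : y \notin K.
    by rewrite !inE !negb_or -!andbA; apply/and4P; split; rewrite eq_sym.
  have nc6 := near_swap nc2 clK.
  have b6 z : step (swap c2 K i j) b z = step c2 b z by rewrite step_swap_neq.
  have j6 z : step (swap c2 K i j) j z = step c2 (if z \in K then i else j) z.
    by case: ifPn => zK; [rewrite step_swap_in // tpermR|rewrite step_swap_out].
  have yC6 : y \in chain (swap c2 K i j) b j x.
    by apply: near_linked nc6 _ _; rewrite ?b6 // j6 (negPf yK).
  pose L := u |: chain c2 b j y :\ x.
  have uCy : u \notin chain c2 b j y.
    by apply: contra uC2 => /(chain_trans yC2).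
  have clL : step_closed (swap c2 K i j) b j L.
    move=> z; rewrite b6 j6 !in_setU1 !in_setD1.
    case: (eqVneq z u) => [-> _|zu /= /andP[zx zC]].
      rewrite uK bu2 eqxx outK // iu vx; split=> //=; apply/orP; right.
      by have [_] := chain_closed c2 b j y _ SK; rewrite xK2 jx.
    have [bC jC] := chain_closed c2 b j y _ zC; split.
      rewrite bC andbT; apply/orP; right; apply: contra_neq zx => bz.
      by rewrite -(stepK b pc2 z) bz bx2.
    case: ifPn => [|zK]; last first.
      rewrite jC andbT; apply/orP; right; apply: contraNneq zK => jz.
      by rewrite -(stepK j pc2 z) jz xK2 jx.
    rewrite !inE -!orbA => /or4P[]/eqP ez.
    - by rewrite ez eqxx in zx.
    - by move: jC uCy; rewrite ez outK ?uE => [->|]; rewrite // !inE eqxx orbT.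
    - by rewrite ez eqxx in zu.
    - by rewrite ez outK // iv eqxx.
  have yL : y \in L by rewrite in_setU1 in_setD1 chain_refl [y == x]eq_sym xy orbT.
  have := chain_min clL yL; move/subsetP/(_ x); rewrite chain_sym ?yC6; last first.
    exact: near_proper nc6.
  by move/(_ isT); rewrite in_setU1 in_setD1 eqxx (negPf xu).
pose K := chain c2 b j u0.
have clK := chain_closed c2 b j u0.
have xK : x \notin K by rewrite /K chain_sym.
have yK : y \notin K.
  apply: contra u0C2; rewrite /K chain_sym //; exact: chain_trans.
have uK : u \in K.
  have cl1 : step_closed c b j (K :|: chain c2 b j x).
    move=> z; rewrite !in_setU => zK.
    have [bzK jzK] : step c2 b z \in K :|: chain c2 b j x /\
                     step c2 j z \in K :|: chain c2 b j x.
      rewrite !in_setU; case/orP: zK => zK.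
        by have [-> ->] := clK z zK.
      by have [-> ->] := chain_closed c2 b j x _ zK; rewrite !orbT.
    rewrite -!in_setU -(bE z); split=> //.
    case: (eqVneq z y) => [->|zy]; first by rewrite u0E in_setU chain_refl.
    case: (eqVneq z u0) => [->|zu0]; first by rewrite ju0 in_setU yC2 orbT.
    by rewrite -out2.
  have := chain_min cl1 (v := x); rewrite in_setU chain_refl orbT => /(_ isT).
  by move/subsetP/(_ u uC); rewrite in_setU (negPf uC2) orbF.
have u'K : u' \notin K.
  apply/negP => u'K.
  have [] := chain_ends pc2 (or_intror ju02) (or_introl bu2) (or_introl bu2') uK u'K.
  - by apply/eqP; rewrite eq_sym.
  - by apply/eqP; rewrite eq_sym.
  - exact/eqP.
have nc4 := near_swap nc2 clK.
have i4 z : step (swap c2 K b j) i z = step c2 i z by rewrite step_swap_neq // eq_sym.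
apply: (@no_common_color _ e y v j i b nc4) => //.
- by rewrite step_swap_out.
- by rewrite step_swap_out // xK2.
- by rewrite i4 iy2.
- by rewrite i4 out2 // u'E.
- by rewrite i4 iy2 step_swap_in ?chain_refl // tpermL.
- by rewrite i4 out2 // u'E step_swap_out.
- by rewrite step_swap_out.
Qed.


(** For a color a missing at x and at the small vertex, the (i,a)-chain of that
    vertex avoids x and y, and swapping it makes the vertex miss i. *)
Lemma near_free c e y i j : near_coloring c e x y ->
  step c i y = y -> Sm (step c j y) ->
  exists a K, [/\ step_closed c i a K, x \notin K, y \notin K,
    step c a x = x & step (swap c K i a) i (step c j y) = step c j y].
Proof.
move=> nc iy; move uE : (step c j y) => u su; have pc := near_proper nc.
have [a au ax] := small_common nc su.
have yC := near_linked nc ax iy.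
have xy := near_neq nc; have xu := small_neq su.
have yu : y != u by apply: contraNneq (small_right nc) => ->.
have uC : u \notin chain c a i x.
  apply/negP => uC.
  by have [] := chain_ends pc (or_introl ax) (or_intror iy) (or_introl au) yC uC;
    apply/eqP.
have cl := step_closedC (chain_closed c a i u).
exists a, (chain c a i u); split=> //.
- by rewrite chain_sym.
- by apply: contra uC; rewrite chain_sym //; apply: chain_trans.
- by rewrite step_swap_in ?chain_refl // tpermL.
Qed.

(** Reduction to [bad_pair_core]: the cases with a missing color are excluded by
    the lemmas on two missing colors, and [near_free] makes u0 miss i.  If that
    swap reaches v, then, with y missing j after the recoloring and the uncolored
    edge rotated to xv, the color a missing at x is missing at v or leads from v
    to a small vertex. *)
Lemma bad_pair c e y w v i j : near_coloring c e x y ->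
  step c i y = y -> step c i x = w -> w != x -> step c j x = v -> v != x ->
  i != j -> bad c j y -> bad c j w -> bad c i v -> False.
Proof.
move=> nc iy ix wx jx vx ij /orP[/eqP jy|su0] bw bv.
  case/orP: bw => [/eqP jw|su].
    by move: (two_missing_both nc iy jy ix wx ij); rewrite jw eqxx.
  by move: (two_missing_small nc iy jy ix wx); rewrite su.
have pc := near_proper nc.
have su : Sm (step c j w).
  by case/orP: bw => // /(negP (two_missing_left nc iy ix wx ij su0)).
have [a [K [cl xK yK ax iu0]]] := near_free nc iy su0.
have [ai aj] : a != i /\ a != j.
  split; apply: contraNneq vx => al; last by rewrite -jx -al ax.
  by rewrite -ix -al ax eqxx in wx.
have nc1 := near_swap nc cl; have pc1 := near_proper nc1.
have j1 z : step (swap c K i a) j z = step c j z.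
  by rewrite step_swap_neq // eq_sym.
move: su0 iu0; move u0E : (step c j y) => u0 su0 iu0.
have u0y : u0 != y by rewrite eq_sym; apply: contraNneq (small_right nc) => ->.
have vu0 : v != u0.
  by apply: contraTneq su0 => <-; rewrite -jx; apply: small_step; rewrite jx.
have vy : v != y.
  by apply: contraTneq su0 => vy; rewrite -u0E -vy -jx stepK.
have [c2 nc2 [iy2 _ [jy2 _] out2 eq2]] : exists2 c2, near_coloring c2 e x y & _ :=
  near_toggle nc1 (etrans (step_swap_out _ pc cl yK) iy) iu0 (etrans (j1 y) u0E) u0y.
have x2 l : step c2 l x = step c l x.
  by rewrite out2 ?(near_neq nc) ?(small_neq su0) // step_swap_out.
have jx2 : step c2 j x = v by rewrite x2.
case: (boolP (v \in K)) => vK.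
  have av : step c2 a v = step c i v by rewrite eq2 // step_swap_in // tpermR.
  have [c3 [e3 [nc3 _ _ eq3]]] := near_shift nc2 jy2 jx2 vx.
  have ax3 : step c3 a x = x by rewrite eq3 // x2.
  case/orP: bv => [/eqP iv|su'].
    by apply: (near_no_common nc3 ax3); rewrite eq3 // av.
  by move: (near_fan_small nc3 ax3); rewrite eq3 // av su'.
have iv2 : step c2 i v = step c i v by rewrite out2 // step_swap_out.
case/orP: bv => [iv|su'].
  have := two_missing_left nc2 jy2 jx2 vx (j := i).
  by rewrite iv2 iv iy2 su0 eq_sym ij => /(_ isT isT).
apply: (@bad_pair_core _ e y w v i j nc1) => //.
- by rewrite step_swap_out.
- by rewrite j1 u0E.
- by rewrite j1 u0E.
- by rewrite step_swap_out.
- by rewrite step_swap_out.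
- by rewrite j1.
- by rewrite step_swap_out.
Qed.


Lemma bad_present c e y i : near_coloring c e x y -> bad c i y -> step c i x != x.
Proof.
move=> nc bi; apply/negP => /eqP ix; case/orP: bi => [/eqP iy|].
  exact: near_no_common nc ix iy.
by apply/negP; apply: near_fan_small nc ix.
Qed.

Lemma bad_present_left c e y w i j : near_coloring c e x y ->
  step c i y = y -> step c i x = w -> w != x -> bad c j w -> step c j x != x.
Proof.
move=> nc iy ix wx bj; case: (eqVneq j i) => [->|ji]; first by rewrite ix.
have [c' [e' [nc' _ _ eq]]] := near_shift nc iy ix wx.
by rewrite -(eq j x ji); apply: (bad_present nc'); rewrite /bad eq.
Qed.

(** If i leads from y to a small vertex u, a (d,a)-swap makes u miss d, and the edge
    from y to u is recolored with d.  Away from y and u, the color d is the only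
    one present at x that this disturbs. *)
Lemma near_make_free c e y i d : near_coloring c e x y -> step c d y = y -> bad c i y ->
  exists c', [/\ near_coloring c' e x y, step c' i y = y,
    forall l, step c' l x = step c l x,
    forall l v, step c l x != x -> (l != d) || (step c i y == y) ->
      v != y -> ~~ Sm v -> step c' l v = step c l v &
    forall l, bad c l y -> bad c' l y].
Proof.
move=> nc dy bi; have pc := near_proper nc; have xy := near_neq nc.
case: (eqVneq (step c i y) y) => [iy|iy]; first by exists c.
have su : Sm (step c i y) by case/orP: (bi) => // /eqP e'; rewrite e' eqxx in iy.
have [a [K [cl xK yK ax du]]] := near_free nc dy su.
have pa l : step c l x != x -> l != a by apply: contraNneq => ->; rewrite ax.
have id : i != d by apply: contraNneq iy => ->; rewrite dy.
have ia := pa _ (bad_present nc bi).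
have nc1 := near_swap nc cl.
move: su du iy; move uE : (step c i y) => u su du uy.
have i1 : step (swap c K d a) i y = u by rewrite step_swap_out.
have [c2 nc2 [dy2 _ [iy2 _] out2 eq2]] :=
  near_toggle nc1 (etrans (step_swap_out _ pc cl yK) dy) du i1 uy.
have xu := small_neq su.
exists c2; split=> //.
- by move=> l; rewrite out2 // step_swap_out.
- move=> l v /pa la; rewrite orbF => ld vy sv.
  rewrite out2 //; last by apply: contraNneq sv => ->.
  by rewrite step_swap_neq.
- move=> l bl; have la := pa _ (bad_present nc bl).
  case: (eqVneq l d) => [->|ld]; first by rewrite /bad dy2 su orbT.
  case: (eqVneq l i) => [->|li]; first by rewrite /bad iy2 eqxx.
  by rewrite /bad eq2 // step_swap_out.
Qed.

Definition mult v : nat := #|[set f | (x \in ends f) && (other_end f x == v)]|.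

(** Adding the deficiency makes the bound [load_lt] the same for all neighbors
    of x, whatever their degrees. *)
Definition load v : nat :=
  #|[set f | (v \in ends f) && (Sm (other_end f v) || (other_end f v == x))]|
  + (k - degree v).

Lemma load_split v : v != x ->
  load v = #|[set f | (v \in ends f) && Sm (other_end f v)]|
           + mult v + (k - degree v).
Proof.
move=> vx; rewrite /load; congr (_ + _).
have -> : mult v = #|[set f | (v \in ends f) && (other_end f v == x)]|.
  apply: eq_card => f; rewrite !inE; apply/andP/andP => -[vf /eqP e].
    by rewrite -e other_end_in // other_endK.
  by rewrite -e other_end_in // other_endK.
rewrite -cardsUI [X in _ + X](_ : _ = 0) ?addn0.
  by apply: eq_card => f; rewrite !inE andb_orr.
apply/eqP; rewrite cards_eq0; apply/eqP/setP => f; rewrite !inE.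
apply/negP => /andP[/andP[_ s] /andP[_ /eqP e]]; move: s; rewrite e.
exact/negP.
Qed.

Lemma card_bad c e y v : near_coloring c e x y -> v != x ->
  #|[set i | bad c i v]| =
  #|missing c v| + #|[set f | (v \in ends f) && Sm (other_end f v)]|.
Proof.
move=> nc vx; have pc := near_proper nc; have [_ xe ye none some] := nc.
have -> : [set f | (v \in ends f) && Sm (other_end f v)] =
  [set f | [&& v \in ends f, c f != None & Sm (other_end f v)]].
  apply/setP => f; rewrite !inE; case: (boolP (v \in ends f)) => //= vf.
  case: (eqVneq f e) => [fe|/some -> //]; rewrite fe none /= in vf *.
  by apply: negbTE; rewrite (other_endE vf xe vx).
rewrite -(card_step_edges v Sm pc) -cardsUI [X in _ = _ + X](_ : _ = 0).
  rewrite addn0; apply: eq_card => i; rewrite !inE /bad.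
  by case: (step c i v == v).
apply/eqP; rewrite cards_eq0; apply/eqP/setP => i; rewrite !inE.
by case: (step c i v == v).
Qed.

Lemma card_step_mult c e y v : near_coloring c e x y -> v != x ->
  #|[set i | step c i x == v]| + (v == y) = mult v.
Proof.
move=> nc vx; have pc := near_proper nc; have [_ xe ye none some] := nc.
have -> : [set i | step c i x == v] = [set i | (step c i x != x) && (step c i x == v)].
  apply/setP => i; rewrite !inE; case: (eqVneq (step c i x) v) => [->|].
    by rewrite vx.
  by rewrite andbF.
rewrite (card_step_edges x (pred1 v) pc) /mult.
rewrite [RHS](cardsD1 e) inE xe ye /= eq_sym addnC; congr (_ + _).
apply: eq_card => f; rewrite !inE andbCA; congr (_ && _).
by case: (eqVneq f e) => [->|/some -> //]; rewrite none.
Qed.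

Lemma card_present c e y : near_coloring c e x y -> #|~: missing c x| = (degree x).-1.
Proof.
move=> nc; have := card_missing_near nc (near_left nc).
have := cardsC (missing c x); rewrite card_ord; lia.
Qed.

Lemma load_right c e y : near_coloring c e x y ->
  #|[set i | bad c i y]| + mult y = (load y).+1.
Proof.
move=> nc; have yx : y != x by rewrite eq_sym (near_neq nc).
rewrite (card_bad nc yx) load_split //.
have ye : y \in ends e by rewrite (near_ends _ nc) eqxx orbT.
have := card_missing_near nc ye; have := max_deg y; lia.
Qed.

Lemma load_other c e y w : near_coloring c e x y -> w != x -> w != y ->
  #|[set i | bad c i w]| + mult w = load w.
Proof.
move=> nc wx wy; rewrite (card_bad nc wx) load_split //.
have pc := near_proper nc; have := card_missing w pc; have := max_deg w.
have -> : #|[set f | (w \in ends f) && (c f != None)]| = degree w.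
  apply: eq_card => f; rewrite !inE andbC; case: (eqVneq f e) => [->|fe].
    by rewrite (near_ends _ nc) (negPf wx) (negPf wy) andbF.
  by rewrite (near_some nc fe).
lia.
Qed.

Lemma cardsU_disjoint (T : finType) (A B : {set T}) :
  [disjoint A & B] -> #|A :|: B| = #|A| + #|B|.
Proof. by move=> AB; apply/eqP; rewrite (leq_card_setU A B).2. Qed.

(** The bad colors at y and the colors of the edges from x to y are disjoint
    sets of colors present at x. *)
Lemma load_lt c e y : near_coloring c e x y -> load y < degree x.
Proof.
move=> nc; have yx : y != x by rewrite eq_sym (near_neq nc).
have := load_right nc; have := card_step_mult nc yx; rewrite eqxx.
pose A := [set i | bad c i y]; pose B := [set i | step c i x == y].
rewrite -/A -/B; have pc := near_proper nc.
have AB : [disjoint A & B].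
  apply/pred0P => i /=; rewrite !inE; apply/negP => /andP[bi /eqP ix].
  have iy : step c i y = x by rewrite -ix stepK.
  by move: bi; rewrite /bad iy eq_sym (negPf yx) (negPf small_x).
have sub : A :|: B \subset ~: missing c x.
  apply/subsetP => i; rewrite !inE => /orP[|/eqP->]; last by [].
  exact: bad_present nc.
have := subset_leq_card sub; rewrite (cardsU_disjoint AB) (card_present nc).
have : 0 < degree x by apply/card_gt0P; exists e; rewrite inE (near_left nc).
lia.
Qed.

(** D consists of the edges at x whose color is bad at y.  For each h in D a
    coloring F h in which y misses the color of h makes the color of h available
    for rotation; the color of h' is good for h when, in F h, it is not bad at the
    end of h.  Good colors are present at x but do not count toward the load, and
    [bad_pair] says that of two edges to different vertices one is good for the
    other. *)
Lemma good_relation c e y : near_coloring c e x y ->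
  exists (D : {set edge G}) (R : rel (edge G)),
  [/\ {in D, forall h, (x \in ends h) && (h != e)},
      load y < #|D| + mult y,
      {in D, forall h, load (other_end h x) +
         #|[set h' in D | (other_end h' x != other_end h x) && R h h']|
         < degree x} &
      {in D &, forall h h', other_end h' x != other_end h x ->
         R h h' || R h' h}].
Proof.
move=> nc; have pc := near_proper nc; have [_ xe ye none some] := nc.
have ye' : y \in ends e by rewrite (near_ends _ nc) eqxx orbT.
have [d dy] := near_missing nc ye'.
pose col h := odflt d (c h).
pose D := [set h | [&& x \in ends h, h != e & bad c (col h) y]].
have colD h : h \in D -> [/\ x \in ends h, step c (col h) x = other_end h x,
    c h = Some (col h) & bad c (col h) y].
  rewrite inE => /and3P[xh /some ch b].
  have ch' : c h = Some (col h) by rewrite /col; case: (c h) ch.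
  by split=> //; apply: stepE.
pose freed h c' := [/\ near_coloring c' e x y, step c' (col h) y = y,
    forall l, step c' l x = step c l x,
    forall l v, step c l x != x -> (l != d) || (step c (col h) y == y) ->
      v != y -> ~~ Sm v -> step c' l v = step c l v &
    forall l, bad c l y -> bad c' l y].
have [F FP] : exists F : edge G -> coloring G k,
    forall h, h \in D -> freed h (F h).
  apply: (@fin_all_exists (edge G) (fun=> coloring G k)
            (fun h c' => h \in D -> freed h c')) => h.
  case: (boolP (h \in D)) => [/colD[_ _ _ b]|]; last by exists c.
  have [c' P'] := near_make_free nc dy b.
  by exists c'.
pose R h h' := ~~ bad (F h) (col h') (other_end h x).
have wP h : h \in D -> [/\ other_end h x != x, other_end h x != y &
    ~~ Sm (other_end h x)].
  move=> hD; have [xh sx _ _] := colD h hD; have [nf fy fx _ _] := FP h hD.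
  split; [exact: other_end_neq| |exact: small_nbr].
  apply/eqP => hy; move/eqP: (near_neq nc); apply.
  have pf := near_proper nf.
  by rewrite -[LHS](stepK (col h) pf) fx sx hy fy.
have col_inj : {in D &, injective col}.
  move=> h h' hD hD' e1; have [xh _ ch _] := colD h hD.
  by have [xh' _ ch' _] := colD h' hD'; apply: pc xh xh' ch _; rewrite ch' e1.
exists D, R; split.
- by move=> h; rewrite inE => /and3P[-> ->].
- rewrite -(load_right nc) leq_add2r -(card_in_imset col_inj).
  apply: subset_leq_card; apply/subsetP => i; rewrite inE => bi.
  have [f xf [cf _]] := step_edge (bad_present nc bi).
  apply/imsetP; exists f; last by rewrite /col cf.
  rewrite inE xf /col cf bi andbT /=.
  by apply: contra_eq_neq cf => ->; rewrite none.
- move=> h hD; have [wx wy sw] := wP h hD; have [nf fy fx _ _] := FP h hD.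
  have [xh sx _ _] := colD h hD; set w := other_end h x in wx wy sw sx *.
  have pf := near_proper nf.
  rewrite -(load_other nf wx wy) -(card_step_mult nf wx) (negPf wy) addn0.
  set Rs := [set h' in D | _].
  have RsD h' : h' \in Rs -> h' \in D by rewrite inE => /andP[].
  rewrite -(card_in_imset (f := col) (D := Rs)); last first.
    by move=> h1 h2 /RsD h1D /RsD h2D; apply: col_inj.
  pose A := [set i | bad (F h) i w]; pose B := [set i | step (F h) i x == w].
  rewrite -/A -/B; pose C := col @: Rs.
  have AB : [disjoint A & B].
    apply/pred0P => i /=; rewrite !inE; apply/negP => /andP[bi /eqP ix].
    have iw : step (F h) i w = x by rewrite -ix stepK.
    by move: bi; rewrite /bad iw eq_sym (negPf wx) (negPf small_x).
  have ABC : [disjoint A :|: B & C].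
    apply/pred0P => i /=; rewrite !inE; apply/negP => /andP[bi].
    case/imsetP => h'; rewrite inE => /and3P[hD' ne nb] ei.
    have [xh' sx' _ _] := colD h' hD'.
    case/orP: bi; first by rewrite ei; apply/negP.
    by rewrite ei fx sx'; apply/negP.
  have sub : (A :|: B) :|: C \subset ~: missing (F h) x.
    apply/subsetP => i; rewrite !inE -orbA => /or3P[bi|/eqP->|] //.
      by apply: (bad_present_left nf fy _ wx bi); rewrite fx.
    case/imsetP => h' /RsD hD' ->; have [xh' sx' _ _] := colD h' hD'.
    by rewrite fx sx' other_end_neq.
  have := subset_leq_card sub; rewrite !cardsU_disjoint // (card_present nf).
  have : 0 < degree x by apply/card_gt0P; exists e; rewrite inE (near_left nc).
  rewrite -/C; lia.
- move=> h h' hD hD' ne; rewrite -negb_and; apply/negP => /andP[b b'].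
  wlog id : h h' hD hD' ne b b' / (col h != d) || (step c (col h') y == y).
    move=> W; case: (eqVneq (col h) d) => [hd|hd]; last first.
      by apply: (W h h') => //; rewrite hd.
    by apply: (W h' h) => //; rewrite 1?eq_sym // hd dy eqxx orbT.
  have [wx wy sw] := wP h hD; have [vx vy sv] := wP h' hD'.
  have [nf fy fx fo fb] := FP h hD; have [nf' fy' fx' fo' fb'] := FP h' hD'.
  have [xh sx _ bh] := colD h hD; have [xh' sx' _ bh'] := colD h' hD'.
  have hx : step c (col h) x != x by rewrite sx.
  apply: (@bad_pair (F h) e y (other_end h x) (other_end h' x) (col h) (col h')) => //.
  + by rewrite fx.
  + by rewrite fx.
  + by apply: contra_neq ne => e1; rewrite -sx -sx' e1.
  + exact: fb.
  + have E := fo' (col h) _ hx id vy sv.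
    case: (boolP ((col h != d) || (step c (col h) y == y))) => [id'|].
      by rewrite /bad (fo (col h)) // -E.
    by rewrite negb_or negbK => /andP[/eqP hd]; rewrite hd dy eqxx.
Qed.

End SmallVertices.

Lemma near_degree_sum c e x y : near_coloring c e x y -> k.+2 <= degree x + degree y.
Proof.
move=> nc; have ye : y \in ends e by rewrite (near_ends _ nc) eqxx orbT.
have mx := card_missing_near nc (near_left nc).
have my := card_missing_near nc ye.
have : [disjoint missing c x & missing c y].
  apply/pred0P => i /=; rewrite !inE; apply/negP => /andP[/eqP ix /eqP iy].
  exact: near_no_common nc ix iy.
move/cardsU_disjoint; have := max_card (missing c x :|: missing c y).
rewrite card_ord; lia.
Qed.

(** The missing sets of x, y and z are pairwise disjoint. *)
Lemma near_fan_degree c e x y i : near_coloring c e x y -> step c i y = y ->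
  2 * k.+1 <= degree x + degree y + degree (step c i x).
Proof.
move=> nc iy; set z := step c i x.
have ye : y \in ends e by rewrite (near_ends _ nc) eqxx orbT.
have nc' : near_coloring c e y x.
  have [pc xe exy none some] := nc; split=> //.
  by rewrite -exy other_endK.
have mx := card_missing_near nc (near_left nc).
have my := card_missing_near nc ye.
have mz := card_missing_degree z (near_proper nc).
have d1 : [disjoint missing c x & missing c y].
  apply/pred0P => j /=; rewrite !inE; apply/negP => /andP[/eqP jx /eqP jy].
  exact: near_no_common nc jx jy.
have d2 : [disjoint missing c x :|: missing c y & missing c z].
  apply/pred0P => j /=; rewrite !inE; apply/negP => /andP[/orP[]/eqP jv /eqP jz].
    exact: near_fan_right nc' iy erefl jv jz.
  exact: near_fan_left nc' iy erefl jv jz.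
have := max_card ((missing c x :|: missing c y) :|: missing c z).
rewrite card_ord (cardsU_disjoint d2) (cardsU_disjoint d1); lia.
Qed.

Lemma near_fan_edges c e x y : near_coloring c e x y ->
  k.+1 <= degree y + #|[set f | (x \in ends f) &&
    (2 * k.+1 <= degree x + degree y + degree (other_end f x))]|.
Proof.
move=> nc; have ye : y \in ends e by rewrite (near_ends _ nc) eqxx orbT.
have pc := near_proper nc.
have my := card_missing_near nc ye.
set S := [set f | _]; suff : #|missing c y| <= #|S| by lia.
have c_inj : injective (@Some 'I_k) by apply: Some_inj.
rewrite -(card_imset _ c_inj).
apply: leq_trans (leq_imset_card c _); apply: subset_leq_card.
apply/subsetP => o /imsetP[i]; rewrite inE => /eqP iy ->.
have ix : step c i x != x.
  by apply/negP => /eqP ix; apply: near_no_common nc ix iy.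
have [f xf [cf sf]] := step_edge ix.
apply/imsetP; exists f; last by rewrite cf.
by rewrite inE xf -sf andTb; apply: near_fan_degree nc iy.
Qed.

End Kempe.

(** * Critical graphs *)

Section FromCritical.
Variable G : multigraph.
Implicit Types (f e : edge G) (x v : vertex G).

Lemma subgraph_coloring (W : {set vertex G}) (F : {set edge G})
    (sWF : is_subgraph W F) (k : nat) :
  chromatic_index (subgraph sWF) <= k ->
  exists2 c : coloring G k, proper_coloring c & forall f, (c f != None) = (f \in F).
Proof.
rewrite /chromatic_index; case: ex_minnP => m /existsP[c0 /forallP cm] _ mk.
pose c f : option 'I_k :=
  if insub f is Some sf then Some (widen_ord mk (c0 sf)) else None.
have cE f i : c f = Some i -> exists2 sf : {f | f \in F},
    val sf = f & i = widen_ord mk (c0 sf).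
  by rewrite /c; case: insubP => // sf fF ef [<-]; exists sf.
exists c; last by move=> f; rewrite /c; case: insubP => [sf -> //|/negPf->].
move=> v f g i vf vg /cE[sf ef ->] /cE[sg eg /(congr1 val) /= /val_inj ec].
rewrite -ef -eg; congr val; apply: contraTeq (cm (c0 sf)) => ne.
apply/forall_inPn; exists sf; rewrite ?inE //.
apply/forall_inPn; exists sg; first by rewrite inE ec.
rewrite negb_imply ne; apply/pred0Pn.
have vW : v \in W.
  by apply: (subsetP (forall_inP sWF _ (valP sf))); rewrite ef.
by exists (Sub v vW); rewrite /= !inE ef eg vf vg.
Qed.

Lemma proper_coloring_chromatic k (c : coloring G k) :
  proper_coloring c -> (forall f, c f <> None) -> chromatic_index G <= k.
Proof.
move=> pc tot; rewrite /chromatic_index; case: ex_minnP => m _; apply.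
have [c1 c1E] : exists c1 : edge G -> 'I_k, forall f, c f = Some (c1 f).
  apply: (@fin_all_exists _ (fun=> 'I_k) (fun f i => c f = Some i)) => f.
  case E: (c f) => [i|]; first by exists i.
  by case: (tot f).
apply/existsP; exists (finfun c1); apply/forallP => i.
apply/forall_inP => f; rewrite inE ffunE => /eqP fi.
apply/forall_inP => g; rewrite inE ffunE => /eqP gi.
apply/implyP; apply: contraNT => /pred0Pn[v /andP[/= vf vg]].
by apply/eqP; apply: (pc v f g i); rewrite // c1E ?fi ?gi.
Qed.

Variable k : nat.
Hypothesis hG : delta_critical G k.

Lemma critical_max_degree v : degree v <= k.
Proof. by case: hG => <- _ _; apply: leq_bigmax. Qed.

Lemma critical_no_coloring (c : coloring G k) :
  proper_coloring c -> exists f, c f = None.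
Proof.
move=> pc; case: (pickP (fun f => c f == None)) => [f /eqP|tot]; first by exists f.
case: hG => _ ci _; have := @proper_coloring_chromatic k c pc.
rewrite ci ltnn => total; suff : false by [].
by apply: total => f cf; have := tot f; rewrite cf eqxx.
Qed.

Lemma critical_near e x : x \in ends e ->
  exists c : coloring G k, near_coloring c e x (other_end e x).
Proof.
move=> xe; case: hG => _ ci crit.
have sWF : is_subgraph [set: vertex G] [set~ e].
  by apply/forall_inP => f _; apply: subsetT.
have := crit _ _ sWF; rewrite ci ltnS.
have -> : [set~ e] != setT.
  by apply/negP => /eqP/setP/(_ e); rewrite !inE eqxx.
rewrite orbT => /(_ isT) /subgraph_coloring[c pc cF]; exists c; split=> //.
  by apply/eqP; rewrite -[_ == _]negbK cF !inE eqxx.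
by move=> f fe; rewrite cF !inE.
Qed.

(** Deleting an isolated vertex leaves a proper subgraph with the same chromatic
    index. *)
Lemma critical_no_isolated x : exists e, x \in ends e.
Proof.
case: (pickP (fun e => x \in ends e)) => [e|iso]; first by exists e.
case: hG => _ ci crit.
have sWF : is_subgraph [set~ x] [set: edge G].
  apply/forall_inP => f _; apply/subsetP => v; rewrite !inE.
  by apply: contraTneq => ->; rewrite iso.
have := crit _ _ sWF; rewrite ci ltnS.
have -> : [set~ x] != setT.
  by apply/negP => /eqP/setP/(_ x); rewrite !inE eqxx.
move/(_ isT) => /subgraph_coloring[c pc cF].
have [f] := critical_no_coloring pc.
by move/eqP; rewrite -[_ == _]negbK cF inE.
Qed.

Lemma critical_vertex : exists x : vertex G, True.
Proof.
have pn : @proper_coloring G k (fun=> None) by [].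
have [f _] := critical_no_coloring pn.
have /card_gt0P[x _] : 0 < #|ends f| by rewrite card_ends.
by exists x.
Qed.

Lemma critical_degree_sum e x : x \in ends e ->
  k.+2 <= degree x + degree (other_end e x).
Proof.
by move=> /critical_near[c]; apply: near_degree_sum; exact: critical_no_coloring.
Qed.

Lemma critical_fan_edges e x : x \in ends e ->
  k.+1 <= degree (other_end e x) + #|[set f | (x \in ends f) &&
    (2 * k.+1 <= degree x + degree (other_end e x) + degree (other_end f x))]|.
Proof.
by move=> /critical_near[c]; apply: near_fan_edges; [exact: critical_max_degree|exact: critical_no_coloring].
Qed.

End FromCritical.

Section Handshake.
Variable G : multigraph.

Lemma sum_ends_swap (R : nmodType) (F : edge G -> vertex G -> R) :
  (\sum_(x : vertex G) \sum_(f | x \in ends f) F f x =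
   \sum_(x : vertex G) \sum_(f | x \in ends f) F f (other_end f x))%R.
Proof.
rewrite (exchange_big_dep predT) //= [RHS](exchange_big_dep predT) //=.
apply: eq_bigr => f _.
rewrite (reindex_onto (other_end f) (other_end f)) /=; last first.
  by move=> x xf; rewrite other_endK.
apply: eq_bigl => x; apply/andP/idP => [[xf /eqP e]|xf].
  by rewrite -e other_end_in.
by rewrite other_end_in // other_endK.
Qed.

Lemma handshake : \sum_(x : vertex G) degree x = 2 * #|edge G|.
Proof.
have E x : degree x = \sum_(f | x \in ends f) 1.
  by rewrite sum1_card; apply: eq_card => f; rewrite !inE.
under eq_bigr => x _ do rewrite E.
rewrite (exchange_big_dep predT) //=.
under eq_bigr => f _ do rewrite sum1_card card_ends.
by rewrite sum_nat_const mulnC cardE -cardT.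
Qed.

End Handshake.

Local Open Scope ring_scope.

(** * Discharging *)

Section Discharging.
Variables (R : rcfType) (G : multigraph) (q : R).
Implicit Types (f : edge G) (x y v : vertex G).

Definition small v : bool := (degree v)%:R < q.

Definition small_edges y : nat :=
  #|[set f | (y \in ends f) && small (other_end f y)]|.

Definition gift y : R :=
  if small y then 0 else ((degree y)%:R - q) / (small_edges y)%:R.

Lemma discharge :
  (forall x, small x ->
     q - (degree x)%:R <= \sum_(f | x \in ends f) gift (other_end f x)) ->
  q * #|vertex G|%:R <= (2 * #|edge G|)%:R.
Proof.
move=> H; rewrite -handshake natr_sum.
rewrite -[#|vertex G|]card_ord -sum1_card.
have -> : q * (\sum_(i in 'I_#|vertex G|) 1)%:R = \sum_(v : vertex G) q.
  by rewrite sum1_card card_ord sumr_const mulr_natr.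
rewrite -subr_ge0 -sumrB (bigID small) /=.
have low : \sum_(x | small x) (q - (degree x)%:R) <=
    \sum_(y | ~~ small y) ((degree y)%:R - q).
  apply: (@le_trans _ _ (\sum_(x | small x) \sum_(f | x \in ends f) gift (other_end f x))).
    exact: ler_sum.
  rewrite big_mkcond /=.
  have -> : \sum_x (if small x then \sum_(f | x \in ends f) gift (other_end f x) else 0)
    = \sum_x \sum_(f | x \in ends f) (if small x then gift (other_end f x) else 0).
    by apply: eq_bigr => x _; case: (small x) => //; rewrite big1.
  rewrite (sum_ends_swap (fun f x => if small x then gift (other_end f x) else 0)).
  rewrite [leRHS]big_mkcond /=; apply: ler_sum => y _.
  have -> : \sum_(f | y \in ends f) (if small (other_end f y)
      then gift (other_end f (other_end f y)) else 0) = gift y *+ small_edges y.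
    rewrite -big_mkcondr /= -sumr_const; apply: eq_big => [f|f /andP[yf _]].
      by rewrite inE.
    by rewrite other_endK.
  rewrite /gift; case: ifPn => [_|]; first by rewrite mul0rn.
  rewrite /small -leNgt /= => qy; case: (posnP (small_edges y)) => [->|n0].
    by rewrite mulr0n subr_ge0.
  by rewrite -[leLHS]mulr_natr divfK // pnatr_eq0 -lt0n.
rewrite -(subr_ge0 _) in low; apply: le_trans low _; rewrite addrC lerD2l.
by rewrite -sumrN; apply: ler_sum => x _; rewrite opprB.
Qed.

Lemma small_edges_gt0 f x : x \in ends f -> small x ->
  (0 < small_edges (other_end f x))%N.
Proof.
move=> xf sx; apply/card_gt0P; exists f.
by rewrite inE other_end_in // other_endK.
Qed.

(** The surplus is shared by at most as many edges as y has. *)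
Lemma gift_even_share f x : x \in ends f -> small x ->
  1 - q / (degree (other_end f x))%:R <= gift (other_end f x).
Proof.
move=> xf sx; have n0 := small_edges_gt0 xf sx; set y := other_end f x in n0 *.
have le : (small_edges y <= degree y)%N.
  by apply: subset_leq_card; apply/subsetP => g; rewrite !inE => /andP[].
have dy : 0 < (degree y)%:R :> R by rewrite ltr0n; apply: leq_trans n0 le.
rewrite /gift; case: ifPn => [|].
  by rewrite /small => h; rewrite subr_le0 ler_pdivlMr // mul1r ltW.
rewrite /small -leNgt => qy.
have -> : 1 - q / (degree y)%:R = ((degree y)%:R - q) / (degree y)%:R.
  by rewrite mulrBl divff // lt0r_neq0.
apply: ler_wpM2l; first by rewrite subr_ge0.
by rewrite lef_pV2 ?ler_nat // posrE // ltr0n.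
Qed.

End Discharging.

(** * Small vertices of medium degree *)

Lemma quadratic_bound_linear (R : realFieldType) (P q : R) : 0 < P -> 0 < q ->
  q ^+ 2 + 3 * P * q <= 2 * P ^+ 2 -> 3 * q <= 2 * P.
Proof.
move=> P0 q0 q_le; rewrite leNgt; apply/negP => h.
have : 0 < P * (3 * q - 2 * P) by rewrite mulr_gt0 // subr_gt0.
have : 0 < q ^+ 2 by rewrite exprn_gt0.
by move: q_le; rewrite !expr2; nra.
Qed.

(** Since P - a and P - b add up to d, the right side is d minus q times a function
    of the product ab once a + b is fixed, and is least when a = b. *)
Lemma medium_share (R : realFieldType) (P q d a b : R) :
  0 < P -> 0 < q -> q ^+ 2 + 3 * P * q <= 2 * P ^+ 2 ->
  0 < a -> 0 < b -> a + b = 2 * P - d -> P - q <= d -> d < q ->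
  q - d <= (P - a) * (1 - q / b) + (P - b) * (1 - q / a).
Proof.
move=> P0 q_gt0 q_le a0 b0 ab qd dq.
have q3 := quadratic_bound_linear P0 q_gt0 q_le.
have dP : d < P by lra.
have -> : (P - a) * (1 - q / b) + (P - b) * (1 - q / a) =
  d - q * ((P - a) / b + (P - b) / a).
  have -> : d = 2 * P - a - b by lra.
  by field; rewrite !lt0r_neq0.
have s0 : 0 < 2 * P - d by lra.
have key : (P - a) / b + (P - b) / a <= 2 * d / (2 * P - d).
  have -> : (P - a) / b + (P - b) / a = 2 - (a + b) * (a + b - P) / (a * b).
    by field; rewrite !lt0r_neq0.
  have -> : 2 * d / (2 * P - d) = 2 - 4 * (a + b - P) / (2 * P - d).
    by rewrite ab; field; rewrite lt0r_neq0.
  rewrite lerD2l lerN2 -ab ler_pdivlMr ?mulr_gt0 // mulrAC ler_pdivrMr; last by rewrite ab.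
  have : 0 <= (a + b - P) * (a - b) ^+ 2.
    by rewrite mulr_ge0 ?sqr_ge0 //; lra.
  by move=> h; rewrite -subr_ge0; apply: le_trans h _; rewrite le_eqVlt; apply/orP; left; apply/eqP; ring.
have : q * ((P - a) / b + (P - b) / a) <= q * (2 * d / (2 * P - d)).
  by apply: ler_wpM2l => //; apply: ltW.
suff : q * (2 * d / (2 * P - d)) <= 2 * d - q by lra.
rewrite mulrA ler_pdivrMr //.
(* The difference of the sides is concave in d; the bounds on q make it
   nonnegative at both ends d = P - q and d = q. *)
nra.
Qed.


Section CriticalVertices.
Variables (R : rcfType) (G : multigraph) (k : nat) (q : R).
Hypothesis hG : delta_critical G k.
Hypothesis q_gt0 : 0 < q.
Let P : R := k.+1%:R.
Implicit Types (f e : edge G) (x y : vertex G).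

(** With a the least degree of a neighbor, all neighbors give at least 1 - q/a, and
    by the fan bound P - a of the edges give at least 1 - q/b. *)
Lemma medium_vertex x : q ^+ 2 + 3 * P * q <= 2 * P ^+ 2 ->
  small q x -> P - q <= (degree x)%:R ->
  q - (degree x)%:R <= \sum_(f | x \in ends f) gift q (other_end f x).
Proof.
move=> q_le sx dx; have [e0 xe0] := critical_no_isolated hG x.
pose e := [arg min_(f < e0 | x \in ends f) degree (other_end f x)]%N.
have [xe emin] : x \in ends e /\ forall f, x \in ends f ->
    (degree (other_end e x) <= degree (other_end f x))%N.
  by rewrite /e; case: arg_minnP => // f xf fmin; split.
have fan := critical_fan_edges hG xe; set y := other_end e x in emin fan.
set Z := [set f | _] in fan.
have yk : (degree y <= k)%N := critical_max_degree hG y.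
set d : R := (degree x)%:R in dx *; set a : R := (degree y)%:R.
have y0 : (0 < degree y)%N.
  by apply/card_gt0P; exists e; rewrite inE other_end_in.
have a0 : 0 < a by rewrite ltr0n.
have P0 : 0 < P by rewrite ltr0n.
have dq : d < q := sx.
have q3 := quadratic_bound_linear P0 q_gt0 q_le.
have aP : a + 1 <= P by rewrite /a /P natr1 ler_nat.
pose b := 2 * P - d - a.
have b0 : 0 < b by rewrite /b; lra.
have share := medium_share P0 q_gt0 q_le a0 b0 (b := b) _ dx dq.
apply: le_trans (share _) _; first by rewrite /b; lra.
have dE : d = \sum_(f | x \in ends f) 1.
  by rewrite sumr_const; congr _%:R; apply: eq_card => f; rewrite !inE.
pose m := Num.max 0 ((1 - q / b) - (1 - q / a)).
have m0 : 0 <= m by rewrite /m le_max lexx.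
have mb : (1 - q / b) - (1 - q / a) <= m by rewrite /m le_max lexx orbT.
have low f : x \in ends f -> (1 - q / a) + (if f \in Z then m else 0) <= gift q (other_end f x).
  move=> xf; apply: le_trans (gift_even_share xf sx).
  have mono r s : 0 < r -> r <= s -> 1 - q / r <= 1 - q / s.
    move=> r0 rs; rewrite lerD2l lerN2; apply: ler_wpM2l; first exact: ltW.
    by rewrite lef_pV2 ?posrE //; apply: lt_le_trans rs.
  have la : 1 - q / a <= 1 - q / (degree (other_end f x))%:R.
    by apply: mono => //; rewrite ler_nat emin.
  case: ifPn => [|_]; last by rewrite addr0.
  rewrite inE => /andP[_ big]; rewrite /m maxEle; case: ifP => _; last by rewrite addr0.
  rewrite addrC subrK; apply: mono => //; rewrite /b /P.
  move: big; rewrite -(ler_nat R) natrM !natrD -/d -/a; lra.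
apply: le_trans (ler_sum _ low); rewrite big_split /= -big_mkcondr /=.
have -> : \sum_(f | x \in ends f) (1 - q / a) = d * (1 - q / a).
  by rewrite dE mulr_suml; apply: eq_bigr => f _; rewrite mul1r.
have -> : \sum_(f | (x \in ends f) && (f \in Z)) m = #|Z|%:R * m.
  rewrite sumr_const mulr_natl; congr (_ *+ _); apply: eq_card => f.
  by rewrite unfold_in /= inE; case: (x \in ends f).
have Zm : (P - a) * m <= #|Z|%:R * m.
  apply: ler_wpM2r => //; rewrite lerBlDl /P /a -natrD ler_nat.
  exact: fan.
have Pa : (P - a) * ((1 - q / b) - (1 - q / a)) <= (P - a) * m.
  by apply: ler_wpM2l => //; lra.
have : (P - a) * (1 - q / b) + (P - b) * (1 - q / a) =
  d * (1 - q / a) + (P - a) * ((1 - q / b) - (1 - q / a)).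
  have -> : d = 2 * P - a - b by rewrite /b; ring.
  by move: (q / a) (q / b) => ? ?; ring.
lra.
Qed.
End CriticalVertices.

(** * Small vertices of low degree *)

(** E stands for the edges at x, w for their other ends and L for the loads of
    those ends. *)
Section PairShare.
Variables (T : finType) (W : eqType) (E D : {set T}) (L : T -> nat) (w : T -> W).
Variables (rel_good : rel T) (n M : nat).
Hypothesis subDE : D \subset E.
Hypothesis load_bounds : forall f, f \in E -> (0 < L f <= n)%N.
Hypothesis n_lt : (n < #|E|)%N.
Hypothesis M_ge2 : (2 <= M)%N.
Hypothesis E_gt : (2 * M < #|E|)%N.
Hypothesis D_big : (n < #|D| + M)%N.
Hypothesis fiber_le : forall h, h \in D -> (#|[set h' in D | w h' == w h]| <= M)%N.
Let good_count h := #|[set h' in D | (w h' != w h) && rel_good h h']|.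
Hypothesis load_good : forall h, h \in D -> (L h + good_count h < #|E|)%N.
Hypothesis good_pair : {in D &, forall h h', w h' != w h ->
  rel_good h h' || rel_good h' h}.

(** Of two edges of D with different ends at least one is good for the other, and
    each edge has at most M edges of D with its own end. *)
Lemma good_count_sum : (#|D| * (#|D| - M) <= 2 * \sum_(h in D) good_count h)%N.
Proof.
have gE : (\sum_(h in D) good_count h =
    \sum_(h in D) \sum_(h' in D) ((w h' != w h) && rel_good h h'))%N.
  apply: eq_bigr => h _; rewrite /good_count -sum1dep_card.
  by rewrite big_mkcondr /=; apply: eq_bigr => h' _; case: (_ && _).
have gE' : (\sum_(h in D) good_count h =
    \sum_(h in D) \sum_(h' in D) ((w h' != w h) && rel_good h' h))%N.
  rewrite gE exchange_big /=; apply: eq_bigr => h _; apply: eq_bigr => h' _.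
  by rewrite eq_sym.
rewrite mul2n -addnn {1}gE gE' -big_split /= -sum_nat_const.
apply: leq_sum => h hD; rewrite -big_split /=.
apply: (@leq_trans (\sum_(h' in D) (w h' != w h))%N).
  rewrite leq_subLR; apply: leq_trans (leq_add (fiber_le hD) (leqnn _)).
  rewrite -sum1dep_card big_mkcondr /= -big_split /= -sum1_card.
  by apply: leq_sum => h' _; case: (w h' == w h).
apply: leq_sum => h' hD'; case: (boolP (w h' != w h)) => //= ne.
by have := good_pair hD hD' ne; case: (rel_good h h') => //= ->.
Qed.

(** All loads are at most n = d - 1 - p, where d is the number of edges.  If
    d <= 2M(p+1), the bound d/n is enough.  Otherwise the loads on D average at
    most B, by [good_count_sum], and D is as large as n + 1 - M. *)
Lemma pair_share (R : realFieldType) :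
  2 * M%:R / (2 * M%:R - 1) <= \sum_(f in E) (L f)%:R^-1 :> R.
Proof.
have n0 : (0 < n)%N.
  have [f fE] : exists f, f \in E by apply/card_gt0P; lia.
  by have := load_bounds fE; lia.
set Mr : R := M%:R; have Mr2 : 2 <= Mr by rewrite /Mr (ler_nat R 2).
set nr : R := n%:R; have nr0 : 0 < nr by rewrite ltr0n.
pose p := (#|E|.-1 - n)%N; have pE : #|E| = (n + p).+1 by lia.
have pr0 : 0 <= p%:R :> R by [].
have low f : f \in E -> nr^-1 <= (L f)%:R^-1.
  move=> fE; have /andP[L0 Ln] := load_bounds fE.
  by rewrite lef_pV2 ?posrE ?ltr0n // ler_nat.
have cardE : (#|E|%:R : R) = nr + p%:R + 1 by rewrite pE -natr1 natrD.
case: (leqP #|E| (2 * M * p.+1)) => [le|gt].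
  apply: (@le_trans _ _ (#|E|%:R / nr)).
    rewrite ler_pdivrMr; last by lra.
    rewrite mulrAC ler_pdivlMr // cardE.
    move: le; rewrite -(ler_nat R) cardE !natrM -/Mr -natr1; nra.
  rewrite mulr_natl -sumr_const; exact: ler_sum.
(* B bounds the average load on D when D has n + 1 - M elements; the convex
   function 1/t is bounded below by its tangent line at B. *)
pose B : R := (nr + 2 * p%:R + 2 * Mr - 1) / 2.
have nbig : 2 * Mr + (2 * Mr - 1) * p%:R <= nr.
  move: gt; rewrite -(ler_nat R) -natr1 cardE natrM -natr1 natrM -/Mr; nra.
have B0 : 0 < B by rewrite /B; nra.
have Bn : B <= nr by rewrite /B; nra.
have tangent h : h \in D -> 2 / B - (L h)%:R / B ^+ 2 <= (L h)%:R^-1.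
  move=> hD; have /andP[L0 _] := load_bounds (subsetP subDE _ hD).
  have l0 : 0 < (L h)%:R :> R by rewrite ltr0n.
  rewrite -subr_ge0.
  have -> : (L h)%:R^-1 - (2 / B - (L h)%:R / B ^+ 2) =
     ((L h)%:R - B) ^+ 2 / ((L h)%:R * B ^+ 2).
    by field; rewrite !lt0r_neq0.
  by rewrite divr_ge0 ?sqr_ge0 // mulr_ge0 ?sqr_ge0 // ltW.
have sumL : \sum_(h in D) (L h)%:R <= #|D|%:R * B.
  have : (\sum_(h in D) (L h + good_count h) <= #|D| * (n + p))%N.
    rewrite -sum_nat_const; apply: leq_sum => h hD.
    by have := load_good hD; rewrite pE ltnS.
  rewrite big_split /= -(ler_nat R) natrD natrM natrD -/nr natr_sum.
  have := good_count_sum; rewrite -(ler_nat R) natrM natrM.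
  have MD : (M <= #|D|)%N.
    move: D_big; rewrite -(ltr_nat R) natrD -/nr -/Mr => Dn.
    by rewrite -(ler_nat R) -/Mr; nra.
  rewrite natrB // -/Mr.
  move: D_big; rewrite -(ler_nat R) -natr1 natrD -/nr -/Mr.
  have : 0 <= #|D|%:R :> R by [].
  rewrite /B; move: (\sum_(h in D) (L h)%:R) (_%:R) => sL sg; nra.
have dec : \sum_(f in E) (L f)%:R^-1 =
    \sum_(h in D) (L h)%:R^-1 + \sum_(h in E :\: D) (L h)%:R^-1 :> R.
  by rewrite (big_setID D) /= (setIidPr subDE).
have sumD : #|D|%:R / B <= \sum_(h in D) (L h)%:R^-1.
  apply: le_trans (ler_sum _ tangent).
  rewrite sumrB sumr_const -mulr_suml -[(2 / B) *+ _]mulr_natl.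
  have : (\sum_(h in D) (L h)%:R) / B ^+ 2 <= #|D|%:R * B / B ^+ 2.
    by apply: ler_wpM2r => //; rewrite invr_ge0 sqr_ge0.
  have -> : #|D|%:R * B / B ^+ 2 = #|D|%:R / B.
    by field; rewrite lt0r_neq0.
  have -> : #|D|%:R * (2 / B) = #|D|%:R / B + #|D|%:R / B by ring.
  lra.
have sumR : (#|E|%:R - #|D|%:R) / nr <= \sum_(h in E :\: D) (L h)%:R^-1.
  apply: (@le_trans _ _ (\sum_(h in E :\: D) nr^-1)); last first.
    by apply: ler_sum => h; rewrite inE => /andP[_ hE]; apply: low.
  rewrite sumr_const -[_^-1 *+ _]mulr_natl; apply: ler_wpM2r; first by rewrite invr_ge0 ltW.
  by rewrite cardsD (setIidPr subDE) natrB // subset_leq_card.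
rewrite dec; apply: le_trans (lerD sumD sumR); rewrite cardE.
have Dr : nr + 1 - Mr <= #|D|%:R.
  by move: D_big; rewrite -(ler_nat R) -natr1 natrD -/nr -/Mr; lra.
have invs : nr^-1 <= B^-1 by rewrite lef_pV2.
apply: (@le_trans _ _ ((nr + 1 - Mr) / B + (p%:R + Mr) / nr)); last first.
  have : 0 <= (#|D|%:R - (nr + 1 - Mr)) * (B^-1 - nr^-1).
    by rewrite mulr_ge0 // subr_ge0.
  move: (B^-1) (nr^-1) => b i; nra.
rewrite -subr_ge0 /B.
(* In terms of the nonnegative slacks s and r, the numerator of the difference
   is a polynomial with nonnegative coefficients. *)
pose s := Mr - 2; pose r := nr - (2 * Mr + (2 * Mr - 1) * p%:R).
have s0 : 0 <= s by rewrite /s; lra.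
have r0 : 0 <= r by rewrite /r; lra.
have eM : Mr = 2 + s by rewrite /s; ring.
have en : nr = 2 * (2 + s) + (2 * (2 + s) - 1) * p%:R + r.
  by rewrite -eM /r; ring.
move: pr0 s0 r0 eM en; move: (p%:R : R) s r => p' s r p0 s0 r0 eM en.
have den0 : 0 < nr * (nr + 2 * p' + 2 * Mr - 1) * (2 * Mr - 1).
  rewrite !mulr_gt0 //; nra.
have d1 : 0 < nr + 2 * p' + 2 * Mr - 1 by nra.
have d2 : 0 < 2 * Mr - 1 by lra.
have -> : (nr + 1 - Mr) / ((nr + 2 * p' + 2 * Mr - 1) / 2) + (p' + Mr) / nr -
    2 * Mr / (2 * Mr - 1) =
  ((p' + Mr) * (nr + 2 * p' + 2 * Mr - 1) * (2 * Mr - 1)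
   + 2 * (nr + 1 - Mr) * nr * (2 * Mr - 1)
   - 2 * Mr * nr * (nr + 2 * p' + 2 * Mr - 1)) /
  (nr * (nr + 2 * p' + 2 * Mr - 1) * (2 * Mr - 1)).
  by field; rewrite !lt0r_neq0.
apply: divr_ge0; last exact: ltW.
have -> : (p' + Mr) * (nr + 2 * p' + 2 * Mr - 1) * (2 * Mr - 1)
   + 2 * (nr + 1 - Mr) * nr * (2 * Mr - 1)
   - 2 * Mr * nr * (nr + 2 * p' + 2 * Mr - 1) =
   2 + 4 * r + 2 * (r * r) + 5 * s + 7 * (s * r) + 2 * (s * (r * r))
   + 2 * (s * s) + 2 * (s * (s * r)) + 13 * p' + 7 * (p' * r)
   + 37 * (p' * s) + 18 * (p' * (s * r)) + 24 * (p' * (s * s))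
   + 8 * (p' * (s * (s * r))) + 4 * (p' * (s * (s * s)))
   + 9 * (p' * p') + 30 * (p' * (p' * s)) + 28 * (p' * (p' * (s * s)))
   + 8 * (p' * (p' * (s * (s * s)))).
  by rewrite en eM; ring.
by do ?[apply: addr_ge0]; rewrite ?mulr_ge0.
Qed.

End PairShare.

Lemma mult_le (G : multigraph) (x y : vertex G) :
  y != x -> (mult x y <= multiplicity G)%N.
Proof.
move=> yx; rewrite /multiplicity.
apply: leq_trans (leq_bigmax_cond (x, y) _); last by rewrite /= eq_sym.
apply: subset_leq_card; apply/subsetP => f; rewrite !inE => /andP[xf /eqP <-].
by have [-> _] := other_endP xf.
Qed.

Section LowVertices.
Variables (R : rcfType) (G : multigraph) (k : nat) (q : R).
Hypothesis hG : delta_critical G k.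
Variable x : vertex G.
Hypothesis small_x : small q x.
Hypothesis low_x : (degree x)%:R <= k.+1%:R - q.
Implicit Types (f e : edge G) (y : vertex G).

Let Sm : pred (vertex G) := fun v => small q v && (v != x).

(** Adjacent degrees add up to at least k + 2. *)
Lemma low_nbr f : x \in ends f -> ~~ small q (other_end f x).
Proof.
move=> xf; have := critical_degree_sum hG xf.
rewrite /small -leNgt -(ler_nat R) natrD => h.
by move: h low_x; rewrite -!natr1; lra.
Qed.

Lemma low_not_small : ~~ Sm x. Proof. by rewrite /Sm eqxx andbF. Qed.

Lemma low_small_nbr f : x \in ends f -> ~~ Sm (other_end f x).
Proof. by move=> xf; rewrite /Sm negb_and low_nbr. Qed.

Lemma low_small_deg u : Sm u -> (degree u + degree x <= k)%N.
Proof.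
case/andP=> su _; rewrite -ltnS -(ltr_nat R) natrD.
by move: su low_x; rewrite /small; lra.
Qed.

Lemma low_load f : x \in ends f ->
  load k x Sm (other_end f x) =
  (small_edges q (other_end f x) + (k - degree (other_end f x)))%N.
Proof.
move=> xf; rewrite /load /small_edges; congr (_ + _)%N; apply: eq_card => g.
rewrite !inE; congr (_ && _); rewrite /Sm; case: eqVneq => [->|].
  by rewrite small_x.
by rewrite andbT orbF.
Qed.

Lemma low_load_bounds f : x \in ends f ->
  (0 < load k x Sm (other_end f x) < degree x)%N.
Proof.
move=> xf; apply/andP; split.
  by rewrite low_load // addn_gt0 small_edges_gt0.
have [c nc] := critical_near hG xf.
exact: (load_lt (critical_max_degree hG) (@critical_no_coloring G k hG)
  low_not_small low_small_deg nc).
Qed.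

(** With j the deficiency of a neighbor, its gift is k - q - j divided by its load
    minus j, and a quotient that is at least 1 does not decrease when both of its
    terms are lowered by j. *)
Lemma low_gift f : x \in ends f ->
  (k%:R - q) / (load k x Sm (other_end f x))%:R <= gift q (other_end f x).
Proof.
move=> xf; have /andP[l0 ld] := low_load_bounds xf.
have n0 := small_edges_gt0 xf small_x; rewrite /gift (negPf (low_nbr xf)).
move: l0 ld; rewrite (low_load xf); set y := other_end f x in n0 *.
have yk : (degree y <= k)%N := critical_max_degree hG y.
move: (small_edges q y) n0 => m m0 l0.
rewrite -(ltr_nat R) natrD natrB // => ld.
have m0' : 0 < m%:R :> R by rewrite ltr0n.
have yk' : (degree y)%:R <= k%:R :> R by rewrite ler_nat.
have ld1 : m%:R + (k%:R - (degree y)%:R) + 1 <= (degree x)%:R :> R.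
  by rewrite -natrB // -natrD natr1 ler_nat -(ltr_nat R) natrD natrB.
rewrite ler_pdivrMr; last by lra.
rewrite mulrAC ler_pdivlMr //.
have -> : ((degree y)%:R - q) * (m%:R + (k%:R - (degree y)%:R)) =
  (k%:R - q) * m%:R + (k%:R - (degree y)%:R) * (k%:R - q - (m%:R + (k%:R - (degree y)%:R))) by ring.
rewrite lerDl mulr_ge0 ?subr_ge0 //.
by move: low_x; rewrite -natr1; lra.
Qed.

Lemma low_deg_ge2 : (2 <= degree x)%N.
Proof.
have [e xe] := critical_no_isolated hG x.
have := critical_degree_sum hG xe.
have := critical_max_degree hG (other_end e x); lia.
Qed.

Lemma low_excess_ge0 : 0 <= k%:R - q.
Proof.
have : 2 <= (degree x)%:R :> R by rewrite (ler_nat R 2) low_deg_ge2.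
by move: low_x; rewrite -natr1; lra.
Qed.

Lemma low_simple :
  (degree x)%:R * (2 * q - k%:R + 1 - (degree x)%:R) <= q ->
  q - (degree x)%:R <= \sum_(f | x \in ends f) gift q (other_end f x).
Proof.
move=> qd; have K0 := low_excess_ge0.
have d2 : 2 <= (degree x)%:R :> R by rewrite (ler_nat R 2) low_deg_ge2.
apply: (@le_trans _ _ (\sum_(f | x \in ends f) (k%:R - q) / ((degree x)%:R - 1))); last first.
  apply: ler_sum => f xf; apply: le_trans (low_gift xf).
  have /andP[l0 ld] := low_load_bounds xf.
  apply: ler_wpM2l => //; rewrite lef_pV2 ?posrE ?ltr0n //; last by lra.
  by rewrite lerBrDr natr1 ler_nat.
have -> : \sum_(f | x \in ends f) (k%:R - q) / ((degree x)%:R - 1) =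
   (degree x)%:R * ((k%:R - q) / ((degree x)%:R - 1)).
  by rewrite sumr_const mulr_natl; congr (_ *+ _); apply: eq_card => f; rewrite !inE.
rewrite mulrA ler_pdivlMr; last by lra.
by move: ((degree x)%:R : R) qd => d; nra.
Qed.

(** The last hypothesis says that (k - q)/(2M - 1) covers the part of the deficit
    q - 2M that exceeds k - q. *)
Lemma low_pair (M : nat) : (2 <= M)%N -> (multiplicity G <= M)%N ->
  (2 * M < degree x)%N -> 3 * q + 2 * (degree x)%:R <= 2 * k.+1%:R ->
  2 * M%:R * (2 * q - k%:R + 1 - 2 * M%:R) <= q ->
  q - (degree x)%:R <= \sum_(f | x \in ends f) gift q (other_end f x).
Proof.
move=> M2 muM Md d3 qM; have K0 := low_excess_ge0.
pose L f := load k x Sm (other_end f x).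
have [e0 xe0] := critical_no_isolated hG x.
pose e := [arg max_(f > e0 | x \in ends f) L f]%N.
have [xe emax] : x \in ends e /\ forall f, x \in ends f -> (L f <= L e)%N.
  by rewrite /e; case: arg_maxnP => // f xf fmax; split.
have small_deg3 u : Sm u -> (3 * degree u + 2 * degree x < 2 * k.+1)%N.
  case/andP=> su _; rewrite -(ltr_nat R) natrD !natrM.
  by move: su d3; rewrite /small; lra.
have [c nc] := critical_near hG xe.
have [D [good [DE nD Lgood pairs]]] := good_relation (critical_max_degree hG)
  (@critical_no_coloring G k hG) low_not_small low_small_nbr low_small_deg small_deg3 nc.
pose E := [set f | x \in ends f].
have DE' h : h \in D -> x \in ends h by move/DE/andP=> [].
have share : 2 * M%:R / (2 * M%:R - 1) <= \sum_(f in E) (L f)%:R^-1 :> R.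
  apply: (@pair_share _ _ E D L (fun h => other_end h x) good (L e) M) => //.
  - by apply/subsetP => h /DE' xh; rewrite inE.
  - move=> f; rewrite inE => xf; have /andP[-> _] := low_load_bounds xf.
    exact: emax.
  - by have /andP[] := low_load_bounds xe.
  - apply: leq_trans nD _; rewrite leq_add2l; apply: leq_trans muM.
    by apply: mult_le; rewrite other_end_neq.
  - move=> h hD; apply: leq_trans muM.
    apply: leq_trans (mult_le (other_end_neq (DE' h hD))).
    apply: subset_leq_card; apply/subsetP => f; rewrite !inE.
    by case/andP=> fD ->; rewrite (DE' f fD).
have Mr2 : 2 <= M%:R :> R by rewrite (ler_nat R 2).
have dM : 2 * M%:R <= (degree x)%:R :> R by rewrite -natrM ler_nat ltnW.
apply: (@le_trans _ _ ((k%:R - q) * (2 * M%:R / (2 * M%:R - 1)))).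
  rewrite mulrA ler_pdivlMr; last by lra.
  by move: (M%:R : R) ((degree x)%:R : R) Mr2 dM qM => m d; nra.
apply: (@le_trans _ _ ((k%:R - q) * \sum_(f in E) (L f)%:R^-1)).
  exact: ler_wpM2l.
rewrite mulr_sumr [leLHS](eq_bigl (fun f => x \in ends f)).
  by apply: ler_sum => f; apply: low_gift.
by move=> f; rewrite inE.
Qed.

End LowVertices.

Lemma critical_k_ge2 (G : multigraph) (k : nat) : delta_critical G k -> (2 <= k)%N.
Proof.
move=> hG; have [x _] := critical_vertex hG.
have [e xe] := critical_no_isolated hG x.
have := critical_degree_sum hG xe; have := critical_max_degree hG x.
have := critical_max_degree hG (other_end e x); lia.
Qed.

Lemma average_degree_ge (R : rcfType) (G : multigraph) (k : nat) (q : R) :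
  delta_critical G k -> 0 < q ->
  q ^+ 2 + 3 * k.+1%:R * q <= 2 * k.+1%:R ^+ 2 ->
  (forall x : vertex G, small q x -> (degree x)%:R <= k.+1%:R - q ->
     q - (degree x)%:R <= \sum_(f | x \in ends f) gift q (other_end f x)) ->
  q <= average_degree G R.
Proof.
move=> hG q0 q_le low; have [x0 _] := critical_vertex hG.
have V0 : 0 < #|vertex G|%:R :> R by rewrite ltr0n; apply/card_gt0P; exists x0.
rewrite /average_degree ler_pdivlMr // -natrM; apply: discharge => x sx.
case: (leP (degree x)%:R (k.+1%:R - q)) => [le|/ltW le]; first exact: low.
exact: medium_vertex hG q0 x q_le sx le.
Qed.

(** * Comparison of the bounds *)

Section Numerics.
Variable R : rcfType.

Lemma sqrt17_sqr : Num.sqrt 17 * Num.sqrt 17 = 17 :> R.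
Proof. by rewrite -expr2 sqr_sqrtr. Qed.

(** Close enough to place the crossing of the two bounds between 112 and 113. *)
Lemma sqrt17_bounds : 268 / 65 < Num.sqrt 17 :> R /\
  Num.sqrt 17 < 301 / 73 :> R.
Proof.
have h := sqrt17_sqr; have h0 : 0 <= Num.sqrt 17 :> R := sqrtr_ge0 _.
by split; rewrite ltNge; apply/negP => le; nra.
Qed.

Let c : R := (Num.sqrt 17 - 3) / 2.

Lemma sqrt17_quadratic (P q : R) : 0 < P -> 0 < q -> q <= c * P ->
  q ^+ 2 + 3 * P * q <= 2 * P ^+ 2.
Proof.
move=> P0 q0 qc; have h := sqrt17_sqr.
have c0 : 0 < c by rewrite /c; have [? _] := sqrt17_bounds; lra.
have cc : c * c + 3 * c = 2 by rewrite /c; nra.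
have : q * q <= (c * P) * (c * P) by rewrite ler_pM // ltW.
have : P * q <= P * (c * P) by rewrite ler_wpM2l // ltW.
have : 2 * (P * P) = (c * P) * (c * P) + 3 * (P * (c * P)).
  by rewrite -cc; ring.
rewrite !expr2; lra.
Qed.

Variables (D s : R).
Hypothesis s_ge0 : 0 <= s.
Hypothesis s_sqr : s * s = 2 * D - 1.

Lemma sqrt17_le_q1 : 2 <= D -> D <= 112 -> c * (D + 1) <= (D + s) / 2.
Proof.
move=> D2 D112; have [_ r1] := sqrt17_bounds; rewrite /c.
suff : 9 / 73 * D + 82 / 73 <= s by nra.
rewrite leNgt; apply/negP => h.
have : s * s <= (9 / 73 * D + 82 / 73) * (9 / 73 * D + 82 / 73).
  by rewrite ler_pM // ltW.
have : 0 <= (D - 2) * (112 - D) by rewrite mulr_ge0 // subr_ge0.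
rewrite s_sqr; lra.
Qed.

Lemma q1_le_sqrt17 : 113 <= D -> (D + s) / 2 <= c * (D + 1).
Proof.
move=> D113; have [r0 _] := sqrt17_bounds; rewrite /c.
suff : s <= 8 / 65 * D + 73 / 65 by nra.
rewrite leNgt; apply/negP => h.
have : (8 / 65 * D + 73 / 65) * (8 / 65 * D + 73 / 65) <= s * s.
  by rewrite ler_pM // ?ltW //; lra.
have : 0 <= (D - 113) * (D - 113) by rewrite mulr_ge0 // ?subr_ge0.
rewrite s_sqr; lra.
Qed.

End Numerics.

Section FinalBounds.
Variables (R : rcfType) (G : multigraph) (k : nat).
Hypothesis hG : delta_critical G k.
Let D : R := k%:R.
Let s : R := Num.sqrt (2 * D - 1).
Let c : R := (Num.sqrt 17 - 3) / 2.
Let q1 : R := (D + s) / 2.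
Let d : R := average_degree G R.
Let qM (m : R) : R := (2 * m * D + 2 * m * (2 * m - 1)) / (4 * m - 1).

Lemma degree_bound_ge2 : 2 <= D. Proof. by rewrite /D (ler_nat R 2) (critical_k_ge2 hG). Qed.

Lemma s_ge0 : 0 <= s. Proof. exact: sqrtr_ge0. Qed.

Lemma s_sqr : s * s = 2 * D - 1.
Proof. by rewrite -expr2 sqr_sqrtr //; have := degree_bound_ge2; lra. Qed.

Lemma succ_degree_bound : k.+1%:R = D + 1. Proof. by rewrite /D natr1. Qed.

Lemma general_average_bound : Num.min q1 (c * (D + 1)) <= d.
Proof.
set q := Num.min _ _; have D2 := degree_bound_ge2; have ss := s_sqr; have s0 := s_ge0.
have [r0 _] := sqrt17_bounds R.
have qc : q <= c * (D + 1) by rewrite /q ge_min lexx orbT.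
have qq1 : q <= q1 by rewrite /q ge_min lexx.
have Dq : D <= 2 * q.
  rewrite /q minEle; case: ifP => _; first by rewrite /q1; lra.
  have : 0 <= (Num.sqrt 17 - 268 / 65) * (D + 1) by rewrite mulr_ge0 //; lra.
  by rewrite /c; lra.
apply: (average_degree_ge hG); first by lra.
  by rewrite succ_degree_bound; apply: sqrt17_quadratic qc; lra.
move=> x sx lx; refine (low_simple hG sx lx _); rewrite -/D.
have t0 : 0 <= 2 * q - D by lra.
have ts : 2 * q - D <= s by move: qq1; rewrite /q1; lra.
have : (2 * q - D) * (2 * q - D) <= s * s by rewrite ler_pM.
have : 0 <= (2 * (degree x)%:R - (2 * q - D + 1)) ^+ 2 by rewrite sqr_ge0.
by rewrite expr2; nra.
Qed.

(** Since q is at least (k + sqrt(2k-1))/2, the degrees 2M and 2q - k + 1 - 2M are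
    in this order, and a degree outside of the interval that they bound is handled
    by [low_simple]. *)
Lemma multiplicity_bound (M : nat) : (113 <= k)%N -> (2 <= M)%N ->
  (multiplicity G <= M)%N -> 4 * M%:R <= 1 + s ->
  Num.min (qM M%:R) (c * (D + 1)) <= d.
Proof.
move=> k113 M2 muM Ms; set q := Num.min _ _.
have ss := s_sqr; have s0 := s_ge0.
have D113 : 113 <= D by rewrite /D (ler_nat R 113).
have [r0 r1] := sqrt17_bounds R.
have Mr2 : 2 <= M%:R :> R by rewrite (ler_nat R 2).
have qc : q <= c * (D + 1) by rewrite /q ge_min lexx orbT.
have qqM : q <= qM M%:R by rewrite /q ge_min lexx.
have q1q : q1 <= q.
  rewrite /q le_min q1_le_sqrt17 // andbT /qM ler_pdivlMr; last by lra.
  have : 0 <= (4 * M%:R - 1 - s) ^+ 2 by rewrite sqr_ge0.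
  by rewrite /q1 expr2; nra.
have ts : s <= 2 * q - D by move: q1q; rewrite /q1; lra.
have qM' : 2 * M%:R * (2 * q - D + 1 - 2 * M%:R) <= q.
  move: qqM; rewrite /qM ler_pdivlMr; last by lra.
  by move: (M%:R : R) => m; lra.
apply: (average_degree_ge hG); first by lra.
  by rewrite succ_degree_bound; apply: sqrt17_quadratic qc; lra.
move=> x sx lx.
pose dx : R := (degree x)%:R.
have simple : 0 <= (dx - 2 * M%:R) * (dx - (2 * q - D + 1 - 2 * M%:R)) ->
    q - (degree x)%:R <= \sum_(f | x \in ends f) gift q (other_end f x).
  move=> h; refine (low_simple hG sx lx _); rewrite -/D -/dx.
  by move: (M%:R : R) h qM' => m; nra.
case: (leqP (degree x) (2 * M)) => [le|gt].
  apply: simple; rewrite -mulrNN mulr_ge0 // opprB subr_ge0.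
    by rewrite -natrM ler_nat.
  have : dx <= 2 * M%:R by rewrite -natrM ler_nat.
  lra.
case: (leP (2 * q - D + 1 - 2 * M%:R) dx) => [le|lt].
  by apply: simple; rewrite mulr_ge0 // subr_ge0 // -natrM ler_nat ltnW.
refine (low_pair hG sx lx M2 muM gt _ qM').
rewrite succ_degree_bound -/dx.
have : q <= 41 / 73 * (D + 1).
  apply: le_trans qc _; apply: ler_wpM2r; first by lra.
  by rewrite /c; lra.
lra.
Qed.

End FinalBounds.

Theorem theorem1p1 (R : rcfType) (Delta : nat) (G : multigraph)
    (hG : delta_critical G Delta) :
  let d : R := average_degree G R in
  let D : R := Delta%:R in
  let mu : R := (multiplicity G)%:R in
  [/\ d >= Num.min ((D + Num.sqrt (2 * D - 1)) / 2)
                   ((Num.sqrt 17 - 3) / 2 * (D + 1)),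
      ((Delta <= 112)%N -> d >= (Num.sqrt 17 - 3) / 2 * (D + 1)),
      ((113 <= Delta)%N -> d >= (D + Num.sqrt (2 * D - 1)) / 2) &
      (mu <= Num.max ((1 + Num.sqrt (2 * D - 1)) / 4)
                     (1 / 2 + Num.sqrt 2 / 4
                        * Num.sqrt ((5 - Num.sqrt 17) * D + 3 - Num.sqrt 17)) ->
       d >= Num.min ((2 * mu * D + 2 * mu * (2 * mu - 1)) / (4 * mu - 1))
                    ((Num.sqrt 17 - 3) / 2 * (D + 1)))].
Proof.
move=> d D mu.
have first : Num.min ((D + Num.sqrt (2 * D - 1)) / 2)
    ((Num.sqrt 17 - 3) / 2 * (D + 1)) <= d := general_average_bound R hG.
have D2 : 2 <= D := degree_bound_ge2 R hG.
have s0 : 0 <= Num.sqrt (2 * D - 1) := s_ge0 R Delta.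
have ss : Num.sqrt (2 * D - 1) * Num.sqrt (2 * D - 1) = 2 * D - 1 := s_sqr R hG.
have few : (Delta <= 112)%N -> (Num.sqrt 17 - 3) / 2 * (D + 1) <= d.
  rewrite -(ler_nat R) => D112; apply: le_trans first.
  by rewrite le_min lexx andbT; apply: sqrt17_le_q1.
split=> // [|muD].
  rewrite -(ler_nat R) => D113; apply: le_trans first.
  by rewrite le_min lexx /=; apply: q1_le_sqrt17.
case: (leqP Delta 112) => [le|gt].
  by apply: le_trans (few le); rewrite ge_min lexx orbT.
have D113 : 113 <= D by rewrite /D (ler_nat R 113).
have q1c := q1_le_sqrt17 ss D113.
set s := Num.sqrt (2 * D - 1) in s0 ss q1c muD.
have s15 : 15 <= s by rewrite leNgt; apply/negP => h; nra.
have [r0 r1] := sqrt17_bounds R.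
(* The second term of the maximum exceeds the first only when Delta <= 112,
   by the same comparison as for the two bounds. *)
have mus : 4 * mu <= 1 + s.
  move: muD; rewrite le_max => /orP[|]; first by lra.
  move: q1c; move rE : (Num.sqrt 17) r0 r1 => r r0 r1 q1c.
  set X := (5 - r) * D + 3 - r.
  have X0 : 0 <= X.
    have : 0 <= (5 - r) * (D - 2) by rewrite mulr_ge0 //; lra.
    by rewrite /X; lra.
  have -> : Num.sqrt 2 / 4 * Num.sqrt X = Num.sqrt 2 * Num.sqrt X / 4.
    by rewrite mulrAC.
  have e2 : (Num.sqrt 2 * Num.sqrt X) * (Num.sqrt 2 * Num.sqrt X) = 2 * X.
    by rewrite mulrACA -!expr2 !sqr_sqrtr.
  move: (Num.sqrt 2 * Num.sqrt X) e2 => t e2 muD.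
  suff : t <= s - 1 by lra.
  rewrite leNgt; apply/negP => lt.
  have : (s - 1) * (s - 1) < t * t by rewrite ltr_pM //; lra.
  by rewrite e2 /X; lra.
case: (leqP 2 (multiplicity G)) => [mu2|mu1].
  exact: multiplicity_bound.
(* For multiplicity at most 1 the value of the rational bound at M = 2 is above
   the bound with sqrt 17. *)
have Ms : 4 * 2%:R <= 1 + s by lra.
apply: le_trans (multiplicity_bound hG gt (leqnn 2) (ltnW mu1) Ms).
rewrite le_min; apply/andP; split; last by rewrite ge_min lexx orbT.
apply: (@le_trans _ _ ((Num.sqrt 17 - 3) / 2 * (D + 1))).
  by rewrite ge_min lexx orbT.
rewrite ler_pdivlMr; last by lra.
have : 0 <= (301 / 73 - Num.sqrt 17) * (D + 1) by rewrite mulr_ge0 //; lra.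
rewrite -/D; lra.
Qed.
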